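(* Let $(A,\succ,\prec)$ be a Leibniz-dendriform algebra, $(B=\bigoplus_{i\in\mathbb Z}B_i,\diamond,\omega)$ a quadratic $\mathbb Z$-graded Zinbiel algebra, and let $A\otimes B$ carry the $\mathbb Z$-graded pre-Lie product $$(a\otimes x)\cdot(b\otimes y)=(a\succ b)\otimes (x\diamond y)-(b\prec a)\otimes (y\diamond x).$$ Let $r=\sum_iu_i\otimes v_i\in A\otimes A$ be a solution of the LD-YBE in $(A,\succ,\prec)$ with $r+\tau(r)$ invariant in $A\otimes A$. Define $\Delta_{\succ,r},\Delta_{\prec,r}:A\to A\otimes A$ by $$\Delta_{\succ,r}(a)=(L_\odot(a)\otimes I-I\otimes R_\circ(a))r,\qquad \Delta_{\prec,r}(a)=(L_\star(a)\otimes I-I\otimes R_\prec(a))\tau(r),$$ and $\delta:A\otimes B\to(A\otimes B)\hat\otimes(A\otimes B)$ by $$\delta(a\otimes x)=\Delta_{\succ,r}(a)\bullet\eta_\omega(x)-\tau\Delta_{\prec,r}(a)\bullet\hat\tau\eta_\omega(x).$$ Then $(A\otimes B,\cdot,\delta)$ is a completed pre-Lie bialgebra, and it coincides with the completed quasi-triangular pre-Lie bialgebra $(A\otimes B,\cdot,\delta_{\hat r})$, that is, $\delta=\delta_{\hat r}$, where $$\delta_{\hat r}(X)=-\big(L_\cdot(X)\hat\otimes I+I\hat\otimes(L_\cdot(X)-R_\cdot(X))\big)\hat r\quad(X\in A\otimes B),\qquad \hat r=\sum_i\sum_{j\in\Omega}(u_i\otimes e_j)\otimes(v_i\otimes f_j),$$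 $\{e_j\}_{j\in\Omega}$ being a homogeneous basis of $B$ and $\{f_j\}_{j\in\Omega}$ its homogeneous dual basis with respect to $\omega$.
   Context: All vector spaces are over a field $\mathbb K$; $\tau$ is the flip, $I$ the identity. Algebras are finite-dimensional except $\mathbb Z$-graded ones. $L_\ast(a)b=a\ast b$, $R_\ast(a)b=b\ast a$. Completed tensor products: for $\mathbb Z$-graded $U=\bigoplus U_i$, $V=\bigoplus V_j$, $U\hat\otimes V:=\prod_{i,j}U_i\otimes V_j$ (similarly for three factors); linear maps and the flip ($\hat\tau$) are extended termwise to formal sums. $A$ is in degree $0$, $A\otimes B=\bigoplus_iA\otimes B_i$. $(a_1\otimes a_2)\bullet(x_1\otimes x_2)=(a_1\otimes x_1)\otimes(a_2\otimes x_2)$, extended linearly to formal sums. Leibniz-dendriform algebra: bilinear $\succ,\prec$ such that, with $x\circ y=x\succ y+x\prec y$: $(x\circ y)\succ z=x\succ(y\succ z)-y\succ(x\succ z)$; $y\prec(x\circ z)+(x\succ y)\prec z=x\succ(y\prec z)$; $x\prec(y\circ z)=(x\prec y)\prec z+y\succ(x\prec z)$. Put $x\odot y=x\succ y+y\prec x$, $L_\odot=L_\succ+R_\prec$, $L_\star=L_\circ+R_\circ$. LD-YBE for $r=\sum_iu_i\otimes v_i$: $\sum_{i,j}\big(u_j\otimes u_i\otimes (v_i\circ v_j)-u_i\otimes(v_i\odot u_j)\otimes v_j-(u_i\succ u_j)\otimes v_i\otimes v_j\big)=0$. An element $s\in A\otimes A$ is invariant if $(L_\odot(x)\otimes I-I\otimes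 R_\circ(x))s=0$ and $(L_\star(x)\otimes I-I\otimes R_\prec(x))\tau(s)=0$ for all $x\in A$. Quadratic $\mathbb Z$-graded Zinbiel algebra $(B=\bigoplus B_i,\diamond,\omega)$: each $B_i$ is finite-dimensional, $B_i\diamond B_j\subseteq B_{i+j}$, $x\diamond(y\diamond z)=(x\diamond y)\diamond z+(y\diamond x)\diamond z$, $\omega$ is a non-degenerate skew-symmetric bilinear form, invariant ($\omega(x\diamond y,z)=\omega(y,x\diamond z+z\diamond x)$) and graded (there is $m\in\mathbb Z$ with $\omega(B_i,B_j)=0$ whenever $i+j+m\neq0$). $\eta_\omega:B\to B\hat\otimes B$ is the linear map determined by $\hat\omega(\eta_\omega(b_1),b_2\otimes b_3)=-\omega(b_1,b_2\diamond b_3)$, where $\hat\omega(\sum x_{1,i,\alpha}\otimes x_{2,j,\alpha},y_1\otimes y_2)=\sum\omega(x_{1,i,\alpha},y_1)\omega(x_{2,j,\alpha},y_2)$. Dual basis: $\omega(e_i,f_j)=\delta_{ij}$. Pre-Lie algebra $(L,\cdot)$: $(x\cdot y)\cdot z-x\cdot(y\cdot z)=(y\cdot x)\cdot z-y\cdot(x\cdot z)$; $[x,y]=x\cdot y-y\cdot x$. Completed pre-Lie coalgebra $(L,\delta)$: $L=\bigoplus L_i$, $\delta:L\to L\hat\otimes L$ linear with $(I\hat\otimes\delta)\delta-(\hat\tau\hat\otimes I)(I\hat\otimes\delta)\delta=(\delta\hat\otimes I)\delta-(\hat\tau\hat\otimes I)(\delta\hat\otimes I)\delta$. Completed pre-Lie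 bialgebra $(L,\cdot,\delta)$: $(L,\cdot)$ pre-Lie algebra, $(L,\delta)$ completed pre-Lie coalgebra, and for all $a,b\in L$: $(\delta-\hat\tau\delta)(a\cdot b)-(L_\cdot(a)\hat\otimes I)(\delta-\hat\tau\delta)(b)-(I\hat\otimes L_\cdot(a))(\delta-\hat\tau\delta)(b)-(I\hat\otimes R_\cdot(b))\delta(a)+(R_\cdot(b)\hat\otimes I)\hat\tau\delta(a)=0$; $\delta(a\cdot b-b\cdot a)-(I\hat\otimes(R_\cdot(b)-L_\cdot(b)))\delta(a)-(I\hat\otimes(L_\cdot(a)-R_\cdot(a)))\delta(b)-(L_\cdot(a)\hat\otimes I)\delta(b)+(L_\cdot(b)\hat\otimes I)\delta(a)=0$. A completed pre-Lie bialgebra of the form $(L,\cdot,\delta_{\hat r})$, $\hat r=\sum a_i\otimes b_i\in L\hat\otimes L$, is completed quasi-triangular if $\hat r$ satisfies the $S$-equation $\sum_{i,j}\big((a_i\cdot a_j)\otimes b_i\otimes b_j-a_i\otimes(b_i\cdot a_j)\otimes b_j-a_i\otimes a_j\otimes[b_i,b_j]\big)=0$ and $\hat s=\hat r-\hat\tau(\hat r)$ satisfies $\big(L_\cdot(x)\hat\otimes I+I\hat\otimes(L_\cdot(x)-R_\cdot(x))\big)\hat s=0$ for all $x\in L$. *)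

(* Defs.v *)
From HB Require Import structures.
From mathcomp Require Import all_boot all_order all_algebra finmap.
From mathcomp Require Import sesquilinear.
From mathcomp Require Import all_classical.

Set Implicit Arguments.
Unset Strict Implicit.
Unset Printing Implicit Defensive.

Import GRing.Theory.

Local Open Scope classical_set_scope.
Local Open Scope ring_scope.

(* U (x) V for finite-dimensional U, V, in coordinates: (i, j) is the           *)
(* coefficient of the tensor of the i-th and j-th standard basis vectors.       *)
Section Tensor.
Variable K : fieldType.

Definition tensor (U V : vectType K) : vectType K :=
  'M[K]_(\dim {:U}, \dim {:V}).

Definition tens (U V : vectType K) (u : U) (v : V) : tensor U V :=
  \matrix_(i, j) (coord (vbasis {:U}) i u * coord (vbasis {:V}) j v).

(* The linear map with u (x) v |-> f u v, for a bilinear f. *)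
Definition tlift (U V : vectType K) (W : lmodType K) (f : U -> V -> W)
    (t : tensor U V) : W :=
  \sum_i \sum_j (t : 'M_(_, _)) i j *: f (vbasis {:U})`_i (vbasis {:V})`_j.

Lemma tlift_is_linear (U V : vectType K) (W : lmodType K) (f : U -> V -> W) :
  linear (tlift f).
Proof.
move=> a s t; rewrite /tlift scaler_sumr -big_split; apply: eq_bigr => i _ /=.
rewrite scaler_sumr -big_split; apply: eq_bigr => j _ /=.
by rewrite !mxE scalerDl scalerA.
Qed.

HB.instance Definition _ (U V : vectType K) (W : lmodType K) (f : U -> V -> W) :=
  GRing.isLinear.Build K (tensor U V) W _ (tlift f) (tlift_is_linear f).

Lemma tlift_tens (U V : vectType K) (W : lmodType K) (f : U -> V -> W) :
  bilinear_for *:%R *:%R f -> forall u v, tlift f (tens u v) = f u v.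
Proof.
move=> [fl fr] u v.
pose fl' v' : {linear U -> W} :=
  HB.pack (f^~ v') (GRing.isLinear.Build _ _ _ _ _ (fl v')).
pose fr' u' : {linear V -> W} :=
  HB.pack (f u') (GRing.isLinear.Build _ _ _ _ _ (fr u')).
rewrite [in RHS](coord_vbasis (memvf u)).
rewrite -[RHS]/(fl' v _) linear_sum; apply: eq_bigr => i _.
rewrite linearZ /= -[f _ v]/(fr' _ v) [in RHS](coord_vbasis (memvf v)).
rewrite linear_sum scaler_sumr; apply: eq_bigr => j _.
by rewrite linearZ /= mxE scalerA.
Qed.

Lemma tlift_id (U V : vectType K) (t : tensor U V) : tlift (@tens U V) t = t.
Proof.
apply/matrixP => i j; rewrite /tlift summxE (bigD1 i) //= summxE (bigD1 j) //=.
have fU := basis_free (vbasisP {:U}); have fV := basis_free (vbasisP {:V}).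
rewrite !mxE !coord_free // !eqxx !mulr1.
rewrite big1 ?addr0 => [|k kj]; last first.
  by rewrite !mxE !coord_free // (negbTE kj) !mulr0.
rewrite big1 ?addr0 // => k ki; rewrite summxE big1 // => l _.
by rewrite !mxE !coord_free // (negbTE ki) mul0r mulr0.
Qed.

Lemma eq_tlift (U V : vectType K) (W : lmodType K) (f g : U -> V -> W) :
  f =2 g -> tlift f =1 tlift g.
Proof.
by move=> fg t; apply: eq_bigr => i _; apply: eq_bigr => j _; rewrite fg.
Qed.

Lemma tliftP (U V : vectType K) (W : lmodType K) a (f g : U -> V -> W) t :
  tlift (fun u v => a *: f u v + g u v) t = a *: tlift f t + tlift g t.
Proof.
rewrite /tlift scaler_sumr -big_split; apply: eq_bigr => i _ /=.
rewrite scaler_sumr -big_split; apply: eq_bigr => j _ /=.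
by rewrite scalerDr !scalerA mulrC.
Qed.

Lemma tens_bilinear (U V : vectType K) : bilinear_for *:%R *:%R (@tens U V).
Proof.
split=> [v|u] a x y; apply/matrixP => i j; rewrite !mxE linearP.
  by rewrite mulrDl mulrA.
by rewrite mulrDr mulrCA.
Qed.

Definition tmap (U V U' V' : vectType K) (f : U -> U') (g : V -> V') :
    tensor U V -> tensor U' V' :=
  tlift (fun u v => tens (f u) (g v)).

Definition tswap (U V : vectType K) : tensor U V -> tensor V U :=
  tlift (fun u v => tens v u).

Definition tassoc (U V W : vectType K) :
    tensor U (tensor V W) -> tensor (tensor U V) W :=
  tlift (fun u => tlift (fun v w => tens (tens u v) w)).

End Tensor.

Arguments tswap {K U V}.
Arguments tassoc {K U V W}.
Notation "u *t v" := (tens u v) (at level 40, left associativity) : ring_scope.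

Section Product.
Variables (K : fieldType) (I : Type) (V : I -> lmodType K).

Definition dprod : Type := forall i, V i.

HB.instance Definition _ := gen_eqMixin dprod.
HB.instance Definition _ := gen_choiceMixin dprod.

Let add (f g : dprod) : dprod := fun i => f i + g i.
Let opp (f : dprod) : dprod := fun i => - f i.
Let scale (a : K) (f : dprod) : dprod := fun i => a *: f i.

Let addA : associative add.
Proof. by move=> f g h; apply: functional_extensionality_dep => i; exact: addrA. Qed.
Let addC : commutative add.
Proof. by move=> f g; apply: functional_extensionality_dep => i; exact: addrC. Qed.
Let add0 : left_id ((fun=> 0) : dprod) add.
Proof. by move=> f; apply: functional_extensionality_dep => i; exact: add0r. Qed.
Let addN : left_inverse ((fun=> 0) : dprod) opp add.
Proof. by move=> f; apply: functional_extensionality_dep => i; exact: addNr. Qed.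

HB.instance Definition _ := GRing.isZmodule.Build dprod addA addC add0 addN.

Let scaleA a b f : scale a (scale b f) = scale (a * b) f.
Proof. by apply: functional_extensionality_dep => i; exact: scalerA. Qed.
Let scale1 : left_id 1 scale.
Proof. by move=> f; apply: functional_extensionality_dep => i; exact: scale1r. Qed.
Let scaleDr : right_distributive scale +%R.
Proof. by move=> a f g; apply: functional_extensionality_dep => i; exact: scalerDr. Qed.
Let scaleDl f : {morph scale^~ f : a b / a + b}.
Proof. by move=> a b; apply: functional_extensionality_dep => i; exact: scalerDl. Qed.

HB.instance Definition _ :=
  GRing.Zmodule_isLmodule.Build K dprod scaleA scale1 scaleDr scaleDl.

End Product.

Section DirectSum.
Variables (K : fieldType) (V : int -> vectType K).

Definition finsupp_dprod : {pred dprod V} :=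
  fun f => `[< finite_set [set i | f i != 0] >].

Lemma finsupp_dprod_submod : submod_closed finsupp_dprod.
Proof.
split=> [|a f g /asboolP ff /asboolP fg]; apply/asboolP.
  by rewrite (_ : mkset _ = set0) //; apply/seteqP; split=> i //=; rewrite eqxx.
apply: sub_finite_set (_ : _ `<=` [set i | f i != 0] `|` [set i | g i != 0]) _.
  move=> i /=; have [f0|? _] := eqVneq (f i) 0; last by left.
  have [g0|? _] := eqVneq (g i) 0; last by right.
  by rewrite -[(a *: f + g) i]/(a *: f i + g i) f0 g0 scaler0 addr0 eqxx.
by rewrite finite_setU.
Qed.

HB.instance Definition _ :=
  GRing.isSubmodClosed.Build K (dprod V) finsupp_dprod finsupp_dprod_submod.

Record dsum : Type := DSum {
  dsum_val : dprod V;
  dsum_valP : dsum_val \in finsupp_dprod }.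

HB.instance Definition _ := [isSub of dsum for dsum_val].
HB.instance Definition _ := [Choice of dsum by <:].
HB.instance Definition _ := [SubChoice_isSubLmodule of dsum by <:].

Definition component (x : dsum) (i : int) : V i := dsum_val x i.
Coercion component : dsum >-> Funclass.

Lemma incl_subproof i (x : V i) :
  (eqtype.dfwith (T := V) (fun=> 0) x : dprod V) \in finsupp_dprod.
Proof.
apply/asboolP; apply: sub_finite_set (finite_set1 i) => j /=.
by case: eqtype.dfwithP => [|k _ /eqP[]].
Qed.

Definition incl i (x : V i) : dsum := DSum (incl_subproof x).

Definition homog (i : int) (x : dsum) : Prop := forall k, k != i -> x k = 0.

Lemma dsumP (x y : dsum) : (forall i, x i = y i) <-> x = y.
Proof.
split=> [xy|-> //]; apply: val_inj; exact: functional_extensionality_dep.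
Qed.

Lemma dsum_fin (x : dsum) : finite_set [set i | x i != 0].
Proof. exact/asboolP/dsum_valP. Qed.

Lemma dsum_supp (x : dsum) :
  exists S : {fset int}, forall i, i \notin S -> x i = 0.
Proof.
move/finite_fsetP: (dsum_fin x) => [S HS]; exists S => i iS.
apply/eqP/negPn/negP => xi.
by move/negP: iS; apply; have : [set` S] i by rewrite -HS.
Qed.

Lemma incl0 i : @incl i 0 = 0.
Proof. by apply/dsumP => j /=; case: eqtype.dfwithP. Qed.

Lemma incl_is_linear i : linear (@incl i).
Proof.
move=> a x y; apply/dsumP => j /=.
rewrite -[RHS]/(a *: incl x j + incl y j) /component /=.
have [<-|ij] := eqVneq i j; first by rewrite !eqtype.dfwith_in.
by rewrite !eqtype.dfwith_out // scaler0 addr0.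
Qed.

Lemma dsum_decomp (x : dsum) : x = \sum_(i \in [set: int]) incl (x i).
Proof.
have [S xS] := dsum_supp x.
rewrite (fsbigTE S); last by move=> i /xS ->; exact: incl0.
have valsum (s : seq int) j : (\sum_(i <- s) incl (x i) : dsum) j =
    \sum_(i <- s) incl (x i) j.
  by elim: s => [|k s IH]; rewrite ?big_nil // !big_cons -IH.
apply/dsumP => j; rewrite valsum; have [jS|/[dup] jS /xS ->] := boolP (j \in S).
  rewrite (big_fsetD1 j) //= eqtype.dfwith_in big_seq big1 ?addr0 // => i.
  by rewrite !inE => /andP[ij _]; rewrite eqtype.dfwith_out.
rewrite big_seq big1 // => i iS /=; rewrite eqtype.dfwith_out //.
by apply: contraNneq jS => <-.
Qed.

End DirectSum.

Arguments incl {K V} i x.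

(* Formal sums.  In the definitions below an infinite family of tensors is a    *)
(* componentwise finite one; \sum_(k \in [set: T]) is the sum over the support  *)
(* and has the junk value 0 when the latter is infinite.                        *)
Section Completed.
Variable K : fieldType.
Implicit Types U V W : int -> vectType K.

Definition ctensor U V : lmodType K :=
  dprod (fun i => dprod (fun j => tensor (U i) (V j)) : lmodType K).

Definition ctensor3 U V W : lmodType K :=
  dprod (fun i => dprod (fun j => dprod (fun k =>
    tensor (tensor (U i) (V j)) (W k)) : lmodType K) : lmodType K).

Definition finite_support_family (T : Type) (W : zmodType) (F : T -> W) : Prop :=
  finite_set [set k | F k != 0].

Definition cpure U V (x : dsum U) (y : dsum V) : ctensor U V :=
  fun p q => x p *t y q.

Definition cswap U V (t : ctensor U V) : ctensor V U :=
  fun p q => tswap (t q p).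

Definition cswap12 U V W (t : ctensor3 U V W) : ctensor3 V U W :=
  fun p q s => tmap tswap id (t q p s).

(* The conditions under which a linear map extends termwise to formal sums:     *)
(* each component of the image of a formal sum is a finite sum.                 *)
Definition extendable U V (f : dsum U -> dsum V) : Prop :=
  forall p, finite_set [set i | exists x : U i, f (incl i x) p != 0].

Definition extendable2 U V W (f : dsum U -> ctensor V W) : Prop :=
  forall p q, finite_set [set i | exists x : U i, f (incl i x) p q != 0].

Definition cmap_l U V W (f : dsum U -> dsum V) (t : ctensor U W) : ctensor V W :=
  fun p q => \sum_(i \in [set: int])
    tlift (fun x y => f (incl i x) p *t y) (t i q).

Definition cmap_r U V W (f : dsum V -> dsum W) (t : ctensor U V) : ctensor U W :=
  fun p q => \sum_(i \in [set: int])
    tlift (fun x y => x *t f (incl i y) q) (t p i).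

Definition cmap2_l U V W X (f : dsum U -> ctensor V W) (t : ctensor U X) :
    ctensor3 V W X :=
  fun p q s => \sum_(i \in [set: int])
    tlift (fun x y => f (incl i x) p q *t y) (t i s).

Definition cmap2_r U V W X (f : dsum V -> ctensor W X) (t : ctensor U V) :
    ctensor3 U W X :=
  fun p q s => \sum_(i \in [set: int])
    tlift (fun x y => tassoc (x *t f (incl i y) q s)) (t p i).

End Completed.

Section CompletedPreLie.
Variables (K : fieldType) (V : int -> vectType K).
Let L := dsum V.
Implicit Types (dot : L -> L -> L) (delta : L -> ctensor V V).
Implicit Types (rhat : ctensor V V).

Record prelie_algebra dot : Prop := PreLieAlgebra {
  prelie_bilinear : bilinear_for *:%R *:%R dot;
  prelie_identity : forall x y z,
    dot (dot x y) z - dot x (dot y z) = dot (dot y x) z - dot y (dot x z) }.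

Record completed_prelie_coalgebra delta : Prop := CompletedPreLieCoalgebra {
  coprelie_linear : linear delta;
  coprelie_extendable : extendable2 delta;
  coprelie_identity : forall x,
    cmap2_r delta (delta x) - cswap12 (cmap2_r delta (delta x)) =
    cmap2_l delta (delta x) - cswap12 (cmap2_l delta (delta x)) }.

Record completed_prelie_bialgebra dot delta : Prop := CompletedPreLieBialgebra {
  bialg_prelie : prelie_algebra dot;
  bialg_coprelie : completed_prelie_coalgebra delta;
  bialg_extendable_l : forall a, extendable (dot a);
  bialg_extendable_r : forall a, extendable (dot^~ a);
  bialg_compat1 : forall a b,
    (delta (dot a b) - cswap (delta (dot a b)))
    - cmap_l (dot a) (delta b - cswap (delta b))
    - cmap_r (dot a) (delta b - cswap (delta b))
    - cmap_r (dot^~ b) (delta a)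
    + cmap_l (dot^~ b) (cswap (delta a)) = 0;
  bialg_compat2 : forall a b,
    delta (dot a b - dot b a)
    - cmap_r (fun y => dot y b - dot b y) (delta a)
    - cmap_r (fun y => dot a y - dot y a) (delta b)
    - cmap_l (dot a) (delta b)
    + cmap_l (dot b) (delta a) = 0 }.

(* The three families of the S-equation in degree (p, q, s): k runs over the    *)
(* degrees of the two factors consumed by a product, for                        *)
(* rhat = \sum_i a_i (x) b_i.                                                   *)
Definition S_term1 dot rhat (p q s : int) (k : int * int) :
    tensor (tensor (V p) (V q)) (V s) :=
  tlift (fun a b => tlift (fun a' b' =>
    dot (incl k.1 a) (incl k.2 a') p *t b *t b') (rhat k.2 s)) (rhat k.1 q).

Definition S_term2 dot rhat (p q s : int) (k : int * int) :
    tensor (tensor (V p) (V q)) (V s) :=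
  tlift (fun a b => tlift (fun a' b' =>
    a *t dot (incl k.1 b) (incl k.2 a') q *t b') (rhat k.2 s)) (rhat p k.1).

Definition S_term3 dot rhat (p q s : int) (k : int * int) :
    tensor (tensor (V p) (V q)) (V s) :=
  tlift (fun a b => tlift (fun a' b' =>
    a *t a' *t (dot (incl k.1 b) (incl k.2 b') -
                dot (incl k.2 b') (incl k.1 b) : L) s)
    (rhat q k.2)) (rhat p k.1).

Definition S_equation dot rhat : Prop := forall p q s,
  [/\ finite_support_family (S_term1 dot rhat p q s),
      finite_support_family (S_term2 dot rhat p q s),
      finite_support_family (S_term3 dot rhat p q s) &
      \sum_(k \in [set: int * int]) S_term1 dot rhat p q s k
      - \sum_(k \in [set: int * int]) S_term2 dot rhat p q s k
      - \sum_(k \in [set: int * int]) S_term3 dot rhat p q s k = 0].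

Definition lact dot (x : L) (t : ctensor V V) : ctensor V V :=
  cmap_l (dot x) t + cmap_r (fun y => dot x y - dot y x) t.

Definition delta_of dot rhat (x : L) : ctensor V V := - lact dot x rhat.

Record completed_quasi_triangular dot rhat : Prop := CompletedQuasiTriangular {
  qt_bialgebra : completed_prelie_bialgebra dot (delta_of dot rhat);
  qt_S_equation : S_equation dot rhat;
  qt_invariant : forall x, lact dot x (rhat - cswap rhat) = 0 }.

End CompletedPreLie.

Section LeibnizDendriform.
Variables (K : fieldType) (A : vectType K) (succ prec : A -> A -> A).

Definition ld_circ x y := succ x y + prec x y.
Definition ld_odot x y := succ x y + prec y x.
Definition ld_star x y := ld_circ x y + ld_circ y x.

Record leibniz_dendriform : Prop := LeibnizDendriform {
  ld_axiom1 : forall x y z,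
    succ (ld_circ x y) z = succ x (succ y z) - succ y (succ x z);
  ld_axiom2 : forall x y z,
    prec y (ld_circ x z) + prec (succ x y) z = succ x (prec y z);
  ld_axiom3 : forall x y z,
    prec x (ld_circ y z) = prec (prec x y) z + succ y (prec x z) }.

Definition LD_YBE n (u v : 'I_n -> A) : Prop :=
  \sum_i \sum_j (u j *t u i *t ld_circ (v i) (v j)
                 - u i *t ld_odot (v i) (u j) *t v j
                 - succ (u i) (u j) *t v i *t v j) = 0.

Definition Delta_succ (r : tensor A A) (a : A) : tensor A A :=
  tmap (ld_odot a) id r - tmap id (ld_circ^~ a) r.

Definition Delta_prec (r : tensor A A) (a : A) : tensor A A :=
  tmap (ld_star a) id (tswap r) - tmap id (prec^~ a) (tswap r).

Definition ld_invariant (s : tensor A A) : Prop :=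
  forall x, Delta_succ s x = 0 /\ Delta_prec s x = 0.

End LeibnizDendriform.

Section Zinbiel.
Variables (K : fieldType) (B : int -> vectType K).
Variables (dia : dsum B -> dsum B -> dsum B) (omega : dsum B -> dsum B -> K).

Record quadratic_graded_zinbiel : Prop := QuadraticGradedZinbiel {
  zinbiel_bilinear : bilinear_for *:%R *:%R dia;
  zinbiel_graded : forall i j x y,
    homog i x -> homog j y -> homog (i + j) (dia x y);
  zinbiel_identity : forall x y z,
    dia x (dia y z) = dia (dia x y) z + dia (dia y x) z;
  omega_bilinear : bilinear_for *%R *%R omega;
  omega_skew : forall x y, omega x y = - omega y x;
  omega_nondegenerate : forall x, (forall y, omega x y = 0) -> x = 0;
  omega_invariant : forall x y z,
    omega (dia x y) z = omega y (dia x z + dia z x);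
  omega_graded : exists m : int, forall i j x y,
    homog i x -> homog j y -> i + j + m != 0 -> omega x y = 0 }.

Definition omega_hat (t : ctensor B B) (y1 y2 : dsum B) : K :=
  \sum_(k \in [set: int * int])
    tlift (W := K^o) (fun x1 x2 => omega (incl k.1 x1) y1 * omega (incl k.2 x2) y2)
      (t k.1 k.2).

Definition is_eta (eta : dsum B -> ctensor B B) : Prop :=
  linear eta /\
  forall b1 b2 b3, omega_hat (eta b1) b2 b3 = - omega b1 (dia b2 b3).

Record homogeneous_basis (Omega : choiceType) (e : Omega -> dsum B) : Prop :=
  HomogeneousBasis {
    basis_homog : forall j, exists d, homog d (e j);
    basis_free : forall c : Omega -> K, finite_set [set j | c j != 0] ->
      \sum_(j \in [set: Omega]) c j *: e j = 0 -> forall j, c j = 0;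
    basis_span : forall b, exists c : Omega -> K,
      finite_set [set j | c j != 0] /\
      b = \sum_(j \in [set: Omega]) c j *: e j }.

Definition dual_families (Omega : choiceType) (e f : Omega -> dsum B) : Prop :=
  forall i j, omega (e i) (f j) = (i == j)%:R.

End Zinbiel.

Section TensorProduct.
Variables (K : fieldType) (A : vectType K) (B : int -> vectType K).

Definition AB (i : int) : vectType K := tensor A (B i).

Lemma pten_subproof (a : A) (x : dsum B) :
  ((fun i => a *t x i) : dprod AB) \in finsupp_dprod (V := AB).
Proof.
apply/asboolP; apply: sub_finite_set (dsum_fin x) => i /=.
apply: contra_neq => ->; apply/matrixP => j k; rewrite !mxE linear0 mulr0 //.
Qed.

Definition pten (a : A) (x : dsum B) : dsum AB := DSum (pten_subproof a x).

(* The linear map with a (x) x |-> f a x, for a bilinear f (see gext_pten). *)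
Definition gext (W : lmodType K) (f : A -> dsum B -> W) (X : dsum AB) : W :=
  \sum_(i \in [set: int]) tlift (fun a x => f a (incl i x)) (X i).

Lemma gextE (W : lmodType K) (f : A -> dsum B -> W) (X : dsum AB)
    (S : {fset int}) : (forall i, i \notin S -> X i = 0) ->
  gext f X = \sum_(i <- S) tlift (fun a x => f a (incl i x)) (X i).
Proof. by move=> XS; rewrite /gext (fsbigTE S) // => i /XS ->; exact: linear0. Qed.

Lemma gextP (W : lmodType K) c (f g : A -> dsum B -> W) X :
  gext (fun a x => c *: f a x + g a x) X = c *: gext f X + gext g X.
Proof.
have [S XS] := dsum_supp X; rewrite !(gextE _ XS) scaler_sumr -big_split.
by apply: eq_bigr => i _; rewrite tliftP.
Qed.

Lemma gext_pten (W : lmodType K) (f : A -> dsum B -> W) :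
  bilinear_for *:%R *:%R f -> forall a x, gext f (pten a x) = f a x.
Proof.
move=> [fl fr] a x; have [S xS] := dsum_supp x.
have XS i : i \notin S -> pten a x i = 0.
  move=> /xS; rewrite /component /= => xi0; rewrite -/(component x i) in xi0 *.
  by apply/matrixP => j k; rewrite !mxE xi0 linear0 mulr0.
rewrite (gextE _ XS).
pose fr' : {linear dsum B -> W} :=
  HB.pack (f a) (GRing.isLinear.Build _ _ _ _ _ (fr a)).
rewrite [in RHS](dsum_decomp x) (fsbigTE S); last by move=> i /xS ->; exact: incl0.
rewrite -[RHS]/(fr' _) linear_sum; apply: eq_bigr => i _.
apply: (@tlift_tens _ _ _ _ (fun a x => f a (incl i x))).
split=> [y|b]; first exact: fl.
by move=> c y z; rewrite incl_is_linear fr.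
Qed.

Lemma pten_bilinear : bilinear_for *:%R *:%R pten.
Proof.
split=> [x|a] c y z; apply/dsumP => i; [exact: (tens_bilinear _ _).1|].
exact: (tens_bilinear _ _).2.
Qed.

Definition bullet (s : tensor A A) (t : ctensor B B) : ctensor AB AB :=
  fun p q => tlift (fun a1 a2 =>
    tlift (fun x1 x2 => (a1 *t x1 : AB p) *t (a2 *t x2 : AB q)) (t p q)) s.

Definition AB_dot (succ prec : A -> A -> A) (dia : dsum B -> dsum B -> dsum B)
    (X Y : dsum AB) : dsum AB :=
  gext (fun a x => gext (fun b y =>
    pten (succ a b) (dia x y) - pten (prec b a) (dia y x)) Y) X.

Lemma AB_dot_pten (succ prec : A -> A -> A) (dia : dsum B -> dsum B -> dsum B) :
  bilinear_for *:%R *:%R succ -> bilinear_for *:%R *:%R prec ->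
  bilinear_for *:%R *:%R dia -> forall a b x y,
  AB_dot succ prec dia (pten a x) (pten b y) =
    pten (succ a b) (dia x y) - pten (prec b a) (dia y x).
Proof.
move=> [sl sr] [pl pr] [dl dr] a b x y; have [tl tr] := pten_bilinear.
pose g a x b y := pten (succ a b) (dia x y) - pten (prec b a) (dia y x).
have addBA (c : K) (X1 X2 Y1 Y2 : dsum AB) :
    (c *: X1 + X2) - (c *: Y1 + Y2) = c *: (X1 - Y1) + (X2 - Y2).
  by rewrite scalerBr opprD addrACA.
have gl a1 x1 : bilinear_for *:%R *:%R (g a1 x1).
  split=> [y1|b1] c z t; rewrite /g.
    by rewrite sr pl !tl addBA.
  by rewrite dr dl !tr addBA.
rewrite /AB_dot (gext_pten (f := fun a x => gext (g a x) (pten b y))).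
  exact: gext_pten.
split=> [x1|a1] c z t.
  rewrite -gextP; congr gext; apply/funext => b1; apply/funext => y1.
  by rewrite /g sl pr !tl addBA.
rewrite -gextP; congr gext; apply/funext => b1; apply/funext => y1.
by rewrite /g dl dr !tr addBA.
Qed.

Definition AB_delta (succ prec : A -> A -> A) (r : tensor A A)
    (eta : dsum B -> ctensor B B) (X : dsum AB) : ctensor AB AB :=
  gext (fun a x =>
    bullet (Delta_succ succ prec r a) (eta x)
    - bullet (tswap (Delta_prec succ prec r a)) (cswap (eta x))) X.

Lemma AB_delta_pten (succ prec : {bilinear A -> A -> A}) (r : tensor A A)
    (eta : dsum B -> ctensor B B) : linear eta -> forall a x,
  AB_delta succ prec r eta (pten a x) =
    bullet (Delta_succ succ prec r a) (eta x)
    - bullet (tswap (Delta_prec succ prec r a)) (cswap (eta x)).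
Proof.
move=> eta_lin a x; rewrite /AB_delta.
have bl t c s1 s2 : bullet (c *: s1 + s2) t = c *: bullet s1 t + bullet s2 t.
  apply: functional_extensionality_dep => p.
  by apply: functional_extensionality_dep => q; rewrite /bullet linearP.
have br s c t1 t2 : bullet s (c *: t1 + t2) = c *: bullet s t1 + bullet s t2.
  apply: functional_extensionality_dep => p.
  apply: functional_extensionality_dep => q.
  rewrite -[RHS]/(c *: bullet s t1 p q + bullet s t2 p q) /bullet -tliftP.
  by apply: eq_tlift => a1 a2; rewrite -linearP.
have [tl tr] := @tens_bilinear K A A.
have tmapl (f : A -> A -> A) c a1 a2 (t : tensor A A) : (forall y, linear (f^~ y)) ->
    tmap (f (c *: a1 + a2)) id t = c *: tmap (f a1) id t + tmap (f a2) id t.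
  by move=> fl; rewrite /tmap -tliftP; apply: eq_tlift => y z; rewrite fl tl.
have tmapr (f : A -> A -> A) c a1 a2 (t : tensor A A) : (forall y, linear (f y)) ->
    tmap id (f^~ (c *: a1 + a2)) t = c *: tmap id (f^~ a1) t + tmap id (f^~ a2) t.
  by move=> fl; rewrite /tmap -tliftP; apply: eq_tlift => y z; rewrite fl tr.
have addBA (W : lmodType K) (c : K) (X1 X2 Y1 Y2 : W) :
    (c *: X1 + X2) - (c *: Y1 + Y2) = c *: (X1 - Y1) + (X2 - Y2).
  by rewrite scalerBr opprD addrACA.
have addDA (c : K) (X1 X2 Y1 Y2 : A) :
    (c *: X1 + X2) + (c *: Y1 + Y2) = c *: (X1 + Y1) + (X2 + Y2).
  by rewrite scalerDr addrACA.
have Dsl : linear (Delta_succ succ prec r).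
  move=> c a1 a2; rewrite /Delta_succ tmapl ?tmapr ?addBA // => y d b1 b2.
    by rewrite /ld_circ !linearPr addDA.
  by rewrite /ld_odot linearPl linearPr addDA.
have Dpl : linear (Delta_prec succ prec r).
  move=> c a1 a2; rewrite /Delta_prec tmapl ?tmapr ?addBA // => y d b1 b2.
    by rewrite linearPr.
  by rewrite /ld_star /ld_circ !linearPl !linearPr !addDA.
have swapl (U V : vectType K) : linear (@tswap K U V).
  by move=> c t1 t2; rewrite /tswap linearP.
apply: gext_pten; split=> [y|b] c z t.
  by rewrite Dsl Dpl swapl !bl addBA.
rewrite !eta_lin br [cswap _](_ : _ = c *: cswap (eta z) + cswap (eta t)).
  by rewrite br addBA.
apply: functional_extensionality_dep => p.
apply: functional_extensionality_dep => q.
by rewrite -[RHS]/(c *: tswap (eta z q p) + tswap (eta t q p)) -swapl.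
Qed.

Definition AB_rhat n (u v : 'I_n -> A) (Omega : choiceType)
    (e f : Omega -> dsum B) : ctensor AB AB :=
  fun p q => \sum_(i < n) \sum_(j \in [set: Omega])
    cpure (pten (u i) (e j)) (pten (v i) (f j)) p q.

End TensorProduct.

(* Main.v *)
(* Formal sums are tested against the graded dual of L: a bilinear pairing with
   pairs (triples) of finitely supported functionals separates them and turns the
   completed maps into composition of functionals, so that every identity becomes
   a scalar one.  A homogeneous rhat is then a pair of mutually transposed linear
   maps rho, rho' from the graded dual to L, and
     delta(x)(xi, eta) = - xi(x rho'(eta)) - eta([x, rho(xi)]).
   For an arbitrary pre-Lie algebra the bialgebra axioms follow from the
   S-equation and the invariance of rhat - tau(rhat).  For L = A (x) B the graded
   dual is spanned by the functionals al (x) omega(-, y), on which rho and rho'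
   are the two contractions of r tensored with id and - id.  Since omega(x <> y, z)
   depends, for fixed x, y, z, only on the middle argument, and the three values so
   obtained add up to 0, each remaining identity splits into two identities in A,
   which are consequences of the LD-YBE and of the invariance of r + tau(r). *)
From HB Require Import structures.
Require Import Defs.
From mathcomp Require Import all_boot all_order all_algebra finmap.
From mathcomp Require Import sesquilinear.
From mathcomp Require Import all_classical.
From mathcomp Require Import ring.

Set Implicit Arguments.
Unset Strict Implicit.
Unset Printing Implicit Defensive.

Import Defs GRing.Theory.

Local Open Scope classical_set_scope.
Local Open Scope ring_scope.

(** The obstacle is that [rhat] has infinitely many components, so contracting one leg could give
    only a formal sum, which cannot be multiplied. As [omega (e j) (f j)] is nonzero and [omega] is
    graded by [m], the degrees of [e j] and [f j] add up to [- m]; hence a functional living in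
    finitely many degrees meets finitely many components, and [rho], [rho'] take values in [L]
    itself. The bases then leave the computation: summing over them only reproduces the identity of
    [B], up to a sign. The bialgebra axioms draw on inputs of growing strength. The second
    compatibility comes from the pre-Lie identity and the adjunction between [rho] and [rho']; the
    first also from invariance, which gives the flipped cobracket in terms of [rho xi] and
    [rho' eta]; the coalgebra identity also from the S-equation, read as multiplicativity of
    [- rho'] for the product transposed to the cobracket. Each scalar identity is closed by [eq_by],
    from an explicit linear combination of known equations that [ring] verifies. *)

Lemma eqrD (W : zmodType) (x y u v : W) : x = y -> u = v -> x + u = y + v.
Proof. by move=> -> ->. Qed.

Lemma eqrB (W : zmodType) (x y u v : W) : x = y -> u = v -> x - u = y - v.
Proof. by move=> -> ->. Qed.

Lemma eqrM (R : pzRingType) (c x y : R) : x = y -> c * x = c * y.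
Proof. by move=> ->. Qed.

(* Closes g = h by ring from a linear combination x = y of known equations. *)
Lemma eq_by (W : zmodType) (g h x y : W) : x = y -> g - h = x - y -> g = h.
Proof. by move=> ->; rewrite subrr => /eqP; rewrite subr_eq0 => /eqP. Qed.

(** * Scalar forms on finite-dimensional tensor products *)

Section Tlift.
Variables (K : fieldType) (U V : vectType K).

Lemma tlift_sum (W : lmodType K) (I : Type) (s : seq I) (F : I -> U -> V -> W) t :
  \sum_(i <- s) tlift (F i) t = tlift (fun u v => \sum_(i <- s) F i u v) t.
Proof.
rewrite exchange_big; apply: eq_bigr => i _ /=.
by rewrite exchange_big; apply: eq_bigr => j _ /=; rewrite scaler_sumr.
Qed.

Lemma tlift_eq0 (W : lmodType K) (f : U -> V -> W) t :
  (forall u v, f u v = 0) -> tlift f t = 0.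
Proof.
by move=> f0; rewrite /tlift big1 // => i _; rewrite big1 // => j _; rewrite f0 scaler0.
Qed.

Lemma tlift0 (W : lmodType K) (f : U -> V -> W) : tlift f 0 = 0.
Proof. exact: linear0. Qed.

End Tlift.

Section BilinearForms.
Variables (K : fieldType) (U V : vectType K).

(** [K^o] supplies the module that [tlift] asks for; the result type [K] lets the values be
    multiplied and handed to [ring]. *)
Definition bform (f : U -> V -> K) (t : tensor U V) : K := tlift (W := K^o) f t.

Lemma eq_bform f g t : f =2 g -> bform f t = bform g t.
Proof. by move=> fg; exact: (@eq_tlift _ _ _ K^o). Qed.

Lemma bformP f : linear_for *%R (bform f).
Proof. by move=> a s t; rewrite /bform linearP. Qed.

Lemma bform_eq0 f t : (forall u v, f u v = 0) -> bform f t = 0.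
Proof. exact: (@tlift_eq0 _ _ _ K^o). Qed.

Lemma bform_sum (I : Type) (s : seq I) (F : I -> U -> V -> K) t :
  \sum_(i <- s) bform (F i) t = bform (fun u v => \sum_(i <- s) F i u v) t.
Proof. exact: (@tlift_sum _ _ _ K^o). Qed.

Lemma bformD (F G : U -> V -> K) t :
  bform (fun u v => F u v + G u v) t = bform F t + bform G t.
Proof.
rewrite /bform /tlift -big_split; apply: eq_bigr => i _ /=.
by rewrite -big_split; apply: eq_bigr => j _ /=; rewrite /GRing.scale /= mulrDr.
Qed.

Lemma mulr_bform c (F : U -> V -> K) t : c * bform F t = bform (fun u v => c * F u v) t.
Proof.
rewrite /bform /tlift mulr_sumr; apply: eq_bigr => i _.
by rewrite mulr_sumr; apply: eq_bigr => j _; rewrite /GRing.scale /= mulrCA.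
Qed.

End BilinearForms.

Section ScalarForms.
Variables (K : fieldType) (U : lmodType K) (f : U -> K).
Hypothesis fl : linear_for *%R f.

(** Functionals stay plain functions with a linearity proof, because most of them are composites
    such as [fun x => xi (a ** x)]; the bundled map is rebuilt here once, to transfer the standard
    lemmas. *)
Let f' : {linear U -> K | *%R} := HB.pack f (GRing.isLinear.Build _ _ _ _ _ fl).

Lemma formD x y : f (x + y) = f x + f y. Proof. exact: (linearD f'). Qed.
Lemma formN x : f (- x) = - f x. Proof. exact: (linearN f'). Qed.
Lemma formB x y : f (x - y) = f x - f y. Proof. exact: (linearB f'). Qed.
Lemma formZ a x : f (a *: x) = a * f x. Proof. exact: (linearZ_LR f'). Qed.
Lemma form0 : f 0 = 0. Proof. exact: (linear0 f'). Qed.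
Lemma form_sum (I : Type) (s : seq I) (F : I -> U) :
  f (\sum_(i <- s) F i) = \sum_(i <- s) f (F i).
Proof. exact: (linear_sum f'). Qed.

Lemma form_tlift (V W : vectType K) (h : V -> W -> U) t :
  f (tlift h t) = bform (fun v w => f (h v w)) t.
Proof.
rewrite /bform /tlift form_sum; apply: eq_bigr => i _; rewrite form_sum.
by apply: eq_bigr => j _; rewrite formZ.
Qed.

End ScalarForms.

Section TensorForms.
Variable K : fieldType.
Implicit Types U V W : vectType K.

Definition tform U V (f : U -> K) (g : V -> K) (t : tensor U V) : K :=
  bform (fun u v => f u * g v) t.

Lemma tformP U V (f : U -> K) (g : V -> K) : linear_for *%R (tform f g).
Proof. exact: bformP. Qed.

Lemma tform_tens U V (f : U -> K) (g : V -> K) u v :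
  linear_for *%R f -> linear_for *%R g -> tform f g (u *t v) = f u * g v.
Proof.
move=> fl gl; apply: (@tlift_tens _ _ _ K^o (fun u v => f u * g v)).
split=> [y|x] a b c; first by rewrite fl mulrDl -mulrA.
by rewrite gl mulrDr mulrCA.
Qed.

Lemma tform_tlift U V U' V' (f : U -> K) (g : V -> K) (h : U' -> V' -> tensor U V) t :
  tform f g (tlift h t) = bform (fun u v => tform f g (h u v)) t.
Proof. exact: (form_tlift (tformP f g)). Qed.

Lemma tform_sum U V (f : U -> K) (g : V -> K) (I : Type) (s : seq I) F :
  tform f g (\sum_(i <- s) F i) = \sum_(i <- s) tform f g (F i).
Proof. exact: (form_sum (tformP f g)). Qed.

Lemma tform0 U V (f : U -> K) (g : V -> K) : tform f g 0 = 0.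
Proof. exact: (form0 (tformP f g)). Qed.

Lemma tform_swap U V (f : U -> K) (g : V -> K) t :
  linear_for *%R f -> linear_for *%R g -> tform f g (tswap t) = tform g f t.
Proof.
move=> fl gl; rewrite tform_tlift; apply: eq_bform => v u.
by rewrite tform_tens // mulrC.
Qed.

Lemma coord_linear U i : linear_for *%R (coord (vbasis {:U}) i).
Proof. by move=> a x y; rewrite linearP. Qed.

Lemma tensorE U V (t : tensor U V) i j :
  (t : 'M_(_, _)) i j = tform (coord (vbasis {:U}) i) (coord (vbasis {:V}) j) t.
Proof.
rewrite -[in LHS](tlift_id t) /tlift summxE; apply: eq_bigr => k _.
by rewrite summxE; apply: eq_bigr => l _; rewrite !mxE.
Qed.

Lemma tensor_eq0 U V (t : tensor U V) :
  (forall f g, linear_for *%R f -> linear_for *%R g -> tform f g t = 0) -> t = 0.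
Proof.
by move=> H; apply/matrixP => i j; rewrite tensorE H ?mxE //; exact: coord_linear.
Qed.

Definition tform3 U V W (f : U -> K) (g : V -> K) (h : W -> K) :
  tensor (tensor U V) W -> K := tform (tform f g) h.

Lemma tensor3_eq0 U V W (t : tensor (tensor U V) W) :
  (forall f g h, linear_for *%R f -> linear_for *%R g -> linear_for *%R h ->
    tform3 f g h t = 0) -> t = 0.
Proof.
move=> H; apply: tensor_eq0 => z h zl hl.
(* A functional [z] on [tensor U V] need not be a product. Contracting the last factor of [t] with
   [h] gives an element [w] with [tform z h t = z w], and product functionals suffice to show that
   [w] vanishes. *)
pose w : tensor U V := tlift (fun x c => h c *: x) t.
have zw z' : linear_for *%R z' -> tform z' h t = z' w.
  move=> z'l; rewrite (form_tlift z'l); apply: eq_bform => x c.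
  by rewrite (formZ z'l) mulrC.
rewrite zw // (_ : w = 0) ?(form0 zl) //; apply: tensor_eq0 => f g fl gl.
by rewrite -zw; [exact: H|exact: tformP].
Qed.

End TensorForms.

(** * The restricted graded dual and its pairing with formal sums *)

Section GradedDual.
Variable K : fieldType.
Implicit Types U V W : int -> vectType K.

(* Linear functionals of finite degree support, i.e. the restricted dual. *)
Definition gdual V (xi : dsum V -> K) : Prop :=
  linear_for *%R xi /\
  exists S : {fset int}, forall i x, i \notin S -> xi (incl i x) = 0.

Lemma gdual_decomp V (xi : dsum V -> K) (S : {fset int}) x :
  linear_for *%R xi -> (forall i y, i \notin S -> xi (incl i y) = 0) ->
  xi x = \sum_(i <- S) xi (incl i (x i)).
Proof.
move=> xil xiS; have [S' xS] := dsum_supp x.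
rewrite [in LHS](dsum_decomp x) (fsbigTE (S `|` S')%fset); last first.
  by move=> i; rewrite inE negb_or => /andP[_ /xS ->]; exact: incl0.
rewrite (form_sum xil) -(big_fset_incl _ (A := S)) //.
  exact: fsubsetUl.
by move=> i _ /xiS ->.
Qed.

Lemma component_gdual V p (f : V p -> K) :
  linear_for *%R f -> gdual (fun x : dsum V => f (x p)).
Proof.
move=> fl; split=> [a x y|]; first by rewrite -fl.
exists [fset p]%fset => i x; rewrite inE => ip.
rewrite -(form0 fl); congr f; rewrite /component /=.
by rewrite eqtype.dfwith_out.
Qed.

Lemma extendable_fset U V (f : dsum U -> dsum V) : extendable f ->
  forall p, exists S : {fset int}, forall i x, i \notin S -> f (incl i x) p = 0.
Proof.
move=> fe p; have /finite_fsetP[S HS] := fe p; exists S => i x iS.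
apply/eqP/negPn/negP => fi; move/negP: iS; apply.
by have : [set` S] i by rewrite -HS; exists x.
Qed.

Lemma extendable_of_fset U V (f : dsum U -> dsum V) :
  (forall p, exists S : {fset int}, forall i x, i \notin S -> f (incl i x) p = 0) ->
  extendable f.
Proof.
move=> fS p; have [S SP] := fS p; apply: sub_finite_set (finite_fset S) => i /= [x].
by apply: contra_neqT => /SP ->.
Qed.

Lemma extendable2_fset U V W (f : dsum U -> ctensor V W) : extendable2 f ->
  forall p q, exists S : {fset int}, forall i x, i \notin S -> f (incl i x) p q = 0.
Proof.
move=> fe p q; have /finite_fsetP[S HS] := fe p q; exists S => i x iS.
apply/eqP/negPn/negP => fi; move/negP: iS; apply.
by have : [set` S] i by rewrite -HS; exists x.
Qed.

Lemma fset_family (S : {fset int}) (P : int -> int -> Prop) :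
  (forall p, exists S' : {fset int}, forall i, i \notin S' -> P p i) ->
  exists S' : {fset int}, forall i, i \notin S' -> forall p, p \in S -> P p i.
Proof.
move=> H; pose F p := sval (cid (H p)).
exists (\bigcup_(p <- S) F p)%fset => i iS p pS.
apply: (svalP (cid (H p))); apply: contra iS => iF.
by apply/bigfcupP; exists p => //; rewrite pS.
Qed.

(** Extendability is what preserves finite support: each of the finitely many degrees seen by [xi]
    is reached by [f] from finitely many degrees only. *)
Lemma gdual_comp U V (f : dsum U -> dsum V) xi :
  linear f -> extendable f -> gdual xi -> gdual (fun x => xi (f x)).
Proof.
move=> fl fe [xil [S xiS]]; split=> [a x y|]; first by rewrite fl xil.
have [|S' S'P] := @fset_family S (fun p i => forall x, f (incl i x) p = 0).
  by move=> p; have [S' S'P] := extendable_fset fe p; exists S' => i iS' x; exact: S'P.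
exists S' => i x iS'; rewrite (gdual_decomp _ xil xiS) big_seq big1 // => p pS.
by rewrite S'P // incl0 (form0 xil).
Qed.

Lemma gdual_lin V c (xi eta : dsum V -> K) :
  gdual xi -> gdual eta -> gdual (fun x => c * xi x + eta x).
Proof.
move=> [xil [S xiS]] [etal [S' etaS]]; split=> [a x y|].
  by rewrite xil etal; ring.
exists (S `|` S')%fset => i x; rewrite inE negb_or => /andP[iS iS'].
by rewrite xiS // etaS // mulr0 addr0.
Qed.

Lemma gdualD V (xi eta : dsum V -> K) :
  gdual xi -> gdual eta -> gdual (fun x => xi x + eta x).
Proof.
move=> gx ge; have := gdual_lin 1 gx ge.
by congr gdual; apply/funext => x; rewrite mul1r.
Qed.

Lemma gdual_sep V (x : dsum V) : (forall xi, gdual xi -> xi x = 0) -> x = 0.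
Proof.
move=> H; apply/dsumP => p; rewrite [RHS]/(0 p).
rewrite (coord_vbasis (memvf (x p))) big1 // => i _.
by rewrite (H _ (component_gdual (@coord_linear _ _ i))) scale0r.
Qed.

(** Meant for functionals in the restricted dual; for others an infinite sum takes the default value
    0. [pair2E] turns the sums into explicit finite ones over any finite sets containing the
    supports. *)
Definition pair2 U V (T : ctensor U V) (xi : dsum U -> K) (eta : dsum V -> K) : K :=
  \sum_(p \in [set: int]) \sum_(q \in [set: int])
    tform (fun x => xi (incl p x)) (fun y => eta (incl q y)) (T p q).

Definition pair3 U V W (T : ctensor3 U V W) (xi : dsum U -> K) (eta : dsum V -> K)
    (zeta : dsum W -> K) : K :=
  \sum_(p \in [set: int]) \sum_(q \in [set: int]) \sum_(s \in [set: int])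
    tform3 (fun x => xi (incl p x)) (fun y => eta (incl q y))
      (fun z => zeta (incl s z)) (T p q s).

Lemma tform_0l (U V : vectType K) (f : U -> K) (g : V -> K) t :
  (forall x, f x = 0) -> tform f g t = 0.
Proof. by move=> f0; apply: bform_eq0 => u v; rewrite f0 mul0r. Qed.

Lemma tform_0r (U V : vectType K) (f : U -> K) (g : V -> K) t :
  (forall x, g x = 0) -> tform f g t = 0.
Proof. by move=> f0; apply: bform_eq0 => u v; rewrite f0 mulr0. Qed.

Lemma pair2E U V (T : ctensor U V) xi eta (S S' : {fset int}) :
  (forall i x, i \notin S -> xi (incl i x) = 0) ->
  (forall i x, i \notin S' -> eta (incl i x) = 0) ->
  pair2 T xi eta = \sum_(p <- S) \sum_(q <- S')
    tform (fun x => xi (incl p x)) (fun y => eta (incl q y)) (T p q).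
Proof.
move=> xiS etaS; rewrite /pair2 (fsbigTE S); last first.
  by move=> p pS; rewrite fsbig1 // => q _; apply: tform_0l => x; exact: xiS.
apply: eq_bigr => p _; rewrite (fsbigTE S') // => q qS.
by apply: tform_0r => x; exact: etaS.
Qed.

Lemma pair3E U V W (T : ctensor3 U V W) xi eta zeta (S S' S'' : {fset int}) :
  (forall i x, i \notin S -> xi (incl i x) = 0) ->
  (forall i x, i \notin S' -> eta (incl i x) = 0) ->
  (forall i x, i \notin S'' -> zeta (incl i x) = 0) ->
  pair3 T xi eta zeta = \sum_(p <- S) \sum_(q <- S') \sum_(s <- S'')
    tform3 (fun x => xi (incl p x)) (fun y => eta (incl q y))
      (fun z => zeta (incl s z)) (T p q s).
Proof.
move=> xiS etaS zetaS; rewrite /pair3 (fsbigTE S); last first.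
  move=> p pS; rewrite fsbig1 // => q _; rewrite fsbig1 // => s _.
  by apply: tform_0l => x; apply: tform_0l => y; exact: xiS.
apply: eq_bigr => p _; rewrite (fsbigTE S'); last first.
  move=> q qS; rewrite fsbig1 // => s _.
  by apply: tform_0l => x; apply: tform_0r => y; exact: etaS.
apply: eq_bigr => q _; rewrite (fsbigTE S'') // => s sS.
by apply: tform_0r => x; exact: zetaS.
Qed.

Lemma incl_form V p (xi : dsum V -> K) :
  linear_for *%R xi -> linear_for *%R (fun x => xi (incl p x)).
Proof. by move=> xil a x y; rewrite incl_is_linear xil. Qed.

Lemma incl_component V p (x : V p) : incl p x p = x.
Proof. by rewrite /component /= eqtype.dfwith_in. Qed.

Lemma incl_component_out V p q (x : V p) : q != p -> incl p x q = 0.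
Proof. by move=> pq; rewrite /component /= eqtype.dfwith_out // eq_sym. Qed.

Lemma pair2_component U V (T : ctensor U V) p q f g :
  linear_for *%R f -> linear_for *%R g ->
  pair2 T (fun x => f (x p)) (fun y => g (y q)) = tform f g (T p q).
Proof.
move=> fl gl; rewrite (@pair2E _ _ _ _ _ [fset p]%fset [fset q]%fset).
- rewrite !big_seq_fset1; apply: eq_bform => x y.
  by rewrite !incl_component.
- by move=> i x; rewrite inE eq_sym => ip; rewrite incl_component_out // (form0 fl).
- by move=> i x; rewrite inE eq_sym => ip; rewrite incl_component_out // (form0 gl).
Qed.

Lemma pair3_component U V W (T : ctensor3 U V W) p q s f g h :
  linear_for *%R f -> linear_for *%R g -> linear_for *%R h ->
  pair3 T (fun x => f (x p)) (fun y => g (y q)) (fun z => h (z s)) =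
  tform3 f g h (T p q s).
Proof.
move=> fl gl hl.
rewrite (@pair3E _ _ _ _ _ _ _ [fset p]%fset [fset q]%fset [fset s]%fset).
- rewrite !big_seq_fset1; apply: eq_bform => x y.
  rewrite incl_component; congr (_ * _); apply: eq_bform => a b.
  by rewrite !incl_component.
- by move=> i x; rewrite inE eq_sym => ip; rewrite incl_component_out // (form0 fl).
- by move=> i x; rewrite inE eq_sym => ip; rewrite incl_component_out // (form0 gl).
- by move=> i x; rewrite inE eq_sym => ip; rewrite incl_component_out // (form0 hl).
Qed.

Lemma pair2_eq0 U V (T : ctensor U V) :
  (forall xi eta, gdual xi -> gdual eta -> pair2 T xi eta = 0) -> T = 0.
Proof.
move=> H; apply: functional_extensionality_dep => p.
apply: functional_extensionality_dep => q; apply: tensor_eq0 => f g fl gl.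
by rewrite -pair2_component //; apply: H; exact: component_gdual.
Qed.

Lemma pair3_eq0 U V W (T : ctensor3 U V W) :
  (forall xi eta zeta, gdual xi -> gdual eta -> gdual zeta ->
    pair3 T xi eta zeta = 0) -> T = 0.
Proof.
move=> H; apply: functional_extensionality_dep => p.
apply: functional_extensionality_dep => q.
apply: functional_extensionality_dep => s; apply: tensor3_eq0 => f g h fl gl hl.
by rewrite -pair3_component //; apply: H; exact: component_gdual.
Qed.

Lemma pair2P U V xi eta : gdual xi -> gdual eta ->
  linear_for *%R (fun T : ctensor U V => pair2 T xi eta).
Proof.
move=> [xil [S xiS]] [etal [S' etaS]] a T T'.
rewrite !(pair2E _ xiS etaS) mulr_sumr -big_split; apply: eq_bigr => p _ /=.
rewrite mulr_sumr -big_split; apply: eq_bigr => q _ /=.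
by rewrite -tformP.
Qed.

Lemma pair3P U V W xi eta zeta : gdual xi -> gdual eta -> gdual zeta ->
  linear_for *%R (fun T : ctensor3 U V W => pair3 T xi eta zeta).
Proof.
move=> [xil [S xiS]] [etal [S' etaS]] [zetal [S'' zetaS]] a T T'.
rewrite !(pair3E _ xiS etaS zetaS) mulr_sumr -big_split; apply: eq_bigr => p _ /=.
rewrite mulr_sumr -big_split; apply: eq_bigr => q _ /=.
rewrite mulr_sumr -big_split; apply: eq_bigr => s _ /=.
by rewrite /tform3 -tformP.
Qed.

Lemma pair2Dl U V (T : ctensor U V) xi xi' eta : gdual xi -> gdual xi' -> gdual eta ->
  pair2 T (fun x => xi x + xi' x) eta = pair2 T xi eta + pair2 T xi' eta.
Proof.
move=> [xil [S xiS]] [xi'l [S' xi'S]] [etal [R etaR]].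
have SU i x : i \notin (S `|` S')%fset -> xi (incl i x) = 0.
  by rewrite inE negb_or => /andP[/xiS].
have SU' i x : i \notin (S `|` S')%fset -> xi' (incl i x) = 0.
  by rewrite inE negb_or => /andP[_ /xi'S].
have SD i x : i \notin (S `|` S')%fset -> xi (incl i x) + xi' (incl i x) = 0.
  by move=> iS; rewrite SU // SU' // addr0.
rewrite (pair2E _ SD etaR) (pair2E _ SU etaR) (pair2E _ SU' etaR) -big_split.
apply: eq_bigr => p _; rewrite -big_split; apply: eq_bigr => q _ /=.
by rewrite -bformD; apply: eq_bform => x y; rewrite mulrDl.
Qed.

Lemma pair2_cpure U V (x : dsum U) (y : dsum V) xi eta : gdual xi -> gdual eta ->
  pair2 (cpure x y) xi eta = xi x * eta y.
Proof.
move=> [xil [S xiS]] [etal [S' etaS]]; rewrite (pair2E _ xiS etaS).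
rewrite (gdual_decomp x xil xiS) (gdual_decomp y etal etaS) mulr_suml.
apply: eq_bigr => p _; rewrite mulr_sumr; apply: eq_bigr => q _.
by rewrite tform_tens //; exact: incl_form.
Qed.

Lemma pair2_swap U V (T : ctensor U V) xi eta : gdual xi -> gdual eta ->
  pair2 (cswap T) eta xi = pair2 T xi eta.
Proof.
move=> [xil [S xiS]] [etal [S' etaS]].
rewrite (pair2E _ xiS etaS) (pair2E _ etaS xiS) exchange_big /=.
apply: eq_bigr => p _; apply: eq_bigr => q _.
by rewrite tform_swap //; exact: incl_form.
Qed.

Lemma pair2Dr U V (T : ctensor U V) xi eta eta' : gdual xi -> gdual eta -> gdual eta' ->
  pair2 T xi (fun y => eta y + eta' y) = pair2 T xi eta + pair2 T xi eta'.
Proof.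
move=> gx ge ge'; rewrite -(pair2_swap T gx (gdualD ge ge')).
by rewrite pair2Dl // !pair2_swap.
Qed.

Lemma pair3_swap12 U V W (T : ctensor3 U V W) xi eta zeta :
  gdual xi -> gdual eta -> gdual zeta ->
  pair3 (cswap12 T) eta xi zeta = pair3 T xi eta zeta.
Proof.
move=> [xil [S xiS]] [etal [S' etaS]] [zetal [S'' zetaS]].
rewrite (pair3E _ xiS etaS zetaS) (pair3E _ etaS xiS zetaS) exchange_big /=.
apply: eq_bigr => p _; apply: eq_bigr => q _; apply: eq_bigr => s _.
rewrite /tform3 /cswap12 /tmap tform_tlift; apply: eq_bform => z c.
rewrite tform_tens; [|exact: tformP|exact: incl_form].
by rewrite tform_swap //; exact: incl_form.
Qed.

Lemma pair2_cmap_l U V W (f : dsum U -> dsum V) (T : ctensor U W) xi eta :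
  linear f -> extendable f -> gdual xi -> gdual eta ->
  pair2 (cmap_l f T) xi eta = pair2 T (fun x => xi (f x)) eta.
Proof.
move=> fl fe [xil [S xiS]] [etal [S' etaS]].
(* [R] collects the degrees from which [f] can reach the support [S] of [xi]. Outside [R] the terms
   of both sides vanish, so the sum inside [cmap_l] becomes finite, uniformly in the target degree,
   and can be exchanged with the others. *)
have [|R RP] := @fset_family S (fun p i => forall x, f (incl i x) p = 0).
  by move=> p; have [R RP] := extendable_fset fe p; exists R => i iR x; exact: RP.
have xifR i x : i \notin R -> xi (f (incl i x)) = 0.
  move=> iR; rewrite (gdual_decomp _ xil xiS) big_seq big1 // => p pS.
  by rewrite RP // incl0 (form0 xil).
rewrite (pair2E _ xiS etaS) (pair2E _ xifR etaS).
transitivity (\sum_(p <- S) \sum_(q <- S') \sum_(i <- R) bform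
    (fun x y => xi (incl p (f (incl i x) p)) * eta (incl q y)) (T i q)).
  rewrite !big_seq; apply: eq_bigr => p pS; apply: eq_bigr => q _.
  rewrite /cmap_l (fsbigTE R); last first.
    move=> i iR; apply: tlift_eq0 => x y; rewrite RP //.
    by apply/matrixP => k l; rewrite !mxE linear0 mul0r.
  rewrite tform_sum; apply: eq_bigr => i _; rewrite tform_tlift.
  by apply: eq_bform => x y; rewrite tform_tens //; exact: incl_form.
under eq_bigr do rewrite exchange_big /=.
rewrite exchange_big /=; apply: eq_bigr => i _.
rewrite exchange_big /=; apply: eq_bigr => q _.
rewrite bform_sum; apply: eq_bform => x y.
by rewrite -mulr_suml -gdual_decomp.
Qed.

Lemma pair2_cmap_r U V W (f : dsum V -> dsum W) (T : ctensor U V) xi eta :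
  linear f -> extendable f -> gdual xi -> gdual eta ->
  pair2 (cmap_r f T) xi eta = pair2 T xi (fun x => eta (f x)).
Proof.
move=> fl fe [xil [S' xiS]] [etal [S etaS]].
have [|R RP] := @fset_family S (fun p i => forall x, f (incl i x) p = 0).
  by move=> p; have [R RP] := extendable_fset fe p; exists R => i iR x; exact: RP.
have etafR i x : i \notin R -> eta (f (incl i x)) = 0.
  move=> iR; rewrite (gdual_decomp _ etal etaS) big_seq big1 // => p pS.
  by rewrite RP // incl0 (form0 etal).
rewrite (pair2E _ xiS etaS) (pair2E _ xiS etafR); apply: eq_bigr => p _.
transitivity (\sum_(q <- S) \sum_(i <- R) bform
    (fun x y => xi (incl p x) * eta (incl q (f (incl i y) q))) (T p i)).
  rewrite !big_seq; apply: eq_bigr => q qS.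
  rewrite /cmap_r (fsbigTE R); last first.
    move=> i iR; apply: tlift_eq0 => x y; rewrite RP //.
    by apply/matrixP => k l; rewrite !mxE linear0 mulr0.
  rewrite tform_sum; apply: eq_bigr => i _; rewrite tform_tlift.
  by apply: eq_bform => x y; rewrite tform_tens //; exact: incl_form.
rewrite exchange_big /=; apply: eq_bigr => i _.
rewrite bform_sum; apply: eq_bform => x y.
by rewrite -mulr_sumr -gdual_decomp.
Qed.

Lemma pair3_cmap2_l U V W X (d : dsum U -> ctensor V W) (T : ctensor U X) xi eta zeta :
  linear d -> extendable2 d -> gdual xi -> gdual eta -> gdual zeta ->
  pair3 (cmap2_l d T) xi eta zeta = pair2 T (fun x => pair2 (d x) xi eta) zeta.
Proof.
move=> dl de [xil [S xiS]] [etal [S' etaS]] [zetal [S'' zetaS]].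
have [|R RP] := @fset_family S (fun p i => forall q, q \in S' ->
    forall x, d (incl i x) p q = 0).
  move=> p; apply: fset_family => q.
  have [R RP] := extendable2_fset de p q; exists R => i iR x; exact: RP.
have dR i x : i \notin R -> pair2 (d (incl i x)) xi eta = 0.
  move=> iR; rewrite (pair2E _ xiS etaS) !big_seq big1 // => p pS.
  by rewrite !big_seq big1 // => q qS; rewrite RP // tform0.
rewrite (pair3E _ xiS etaS zetaS) (pair2E _ dR zetaS).
transitivity (\sum_(p <- S) \sum_(q <- S') \sum_(s <- S'') \sum_(i <- R)
    bform (fun x y =>
      tform (fun a => xi (incl p a)) (fun b => eta (incl q b)) (d (incl i x) p q)
      * zeta (incl s y)) (T i s)).
  rewrite !big_seq; apply: eq_bigr => p pS; rewrite !big_seq; apply: eq_bigr => q qS.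
  apply: eq_bigr => s _; rewrite /cmap2_l (fsbigTE R); last first.
    move=> i iR; apply: tlift_eq0 => x y; rewrite RP //.
    by apply/matrixP => k l; rewrite !mxE linear0 mul0r.
  rewrite /tform3 tform_sum; apply: eq_bigr => i _; rewrite tform_tlift.
  by apply: eq_bform => x y; rewrite tform_tens //; [exact: tformP|exact: incl_form].
transitivity (\sum_(p <- S) \sum_(q <- S') \sum_(i <- R) \sum_(s <- S'')
    bform (fun x y =>
      tform (fun a => xi (incl p a)) (fun b => eta (incl q b)) (d (incl i x) p q)
      * zeta (incl s y)) (T i s)).
  by apply: eq_bigr => p _; apply: eq_bigr => q _; rewrite exchange_big.
under eq_bigr do rewrite exchange_big /=.
rewrite exchange_big /=; apply: eq_bigr => i _.
under eq_bigr do rewrite exchange_big /=.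
rewrite exchange_big /=; apply: eq_bigr => s _.
under eq_bigr do rewrite bform_sum.
rewrite bform_sum; apply: eq_bform => x y.
rewrite (pair2E _ xiS etaS) mulr_suml; apply: eq_bigr => p _.
by rewrite mulr_suml.
Qed.

Lemma tform3_tassoc (U V W : vectType K) f g h (u : U) (w : tensor V W) :
  linear_for *%R f -> linear_for *%R g -> linear_for *%R h ->
  tform3 f g h (tassoc (u *t w)) = f u * tform g h w.
Proof.
move=> fl gl hl.
have al : linear_for *%R (fun t => tform3 f g h (@tassoc K U V W t)).
  by move=> a s t; rewrite /tassoc linearP /tform3 tformP.
(* Both sides become forms evaluated at the same tensor [u *t w], so they can be compared on the
   pairs of vectors over which this tensor is expanded. *)
have -> : f u * tform g h w = tform (U := U) (V := tensor V W) f (tform g h) (u *t w).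
  by rewrite tform_tens //; exact: tformP.
rewrite /tassoc /tform3 tform_tlift; apply: eq_bform => x t.
rewrite tform_tlift mulr_bform; apply: eq_bform => b c.
by rewrite !tform_tens //; [rewrite mulrA|exact: tformP].
Qed.

Lemma pair3_cmap2_r U V W X (d : dsum V -> ctensor W X) (T : ctensor U V) xi eta zeta :
  linear d -> extendable2 d -> gdual xi -> gdual eta -> gdual zeta ->
  pair3 (cmap2_r d T) xi eta zeta = pair2 T xi (fun x => pair2 (d x) eta zeta).
Proof.
move=> dl de [xil [S'' xiS]] [etal [S etaS]] [zetal [S' zetaS]].
have [|R RP] := @fset_family S (fun p i => forall q, q \in S' ->
    forall x, d (incl i x) p q = 0).
  move=> p; apply: fset_family => q.
  have [R RP] := extendable2_fset de p q; exists R => i iR x; exact: RP.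
have dR i x : i \notin R -> pair2 (d (incl i x)) eta zeta = 0.
  move=> iR; rewrite (pair2E _ etaS zetaS) !big_seq big1 // => p pS.
  by rewrite !big_seq big1 // => q qS; rewrite RP // tform0.
rewrite (pair3E _ xiS etaS zetaS) (pair2E _ xiS dR); apply: eq_bigr => p _.
transitivity (\sum_(q <- S) \sum_(s <- S') \sum_(i <- R)
    bform (fun x y => xi (incl p x) *
      tform (fun a => eta (incl q a)) (fun b => zeta (incl s b)) (d (incl i y) q s))
      (T p i)).
  rewrite !big_seq; apply: eq_bigr => q qS; rewrite !big_seq; apply: eq_bigr => s sS.
  rewrite /cmap2_r (fsbigTE R); last first.
    move=> i iR; apply: tlift_eq0 => x y; rewrite RP // /tassoc (_ : x *t 0 = 0) ?linear0 //.
    by apply/matrixP => k l; rewrite !mxE linear0 mulr0.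
  rewrite /tform3 tform_sum; apply: eq_bigr => i _; rewrite tform_tlift.
  by apply: eq_bform => x y; rewrite -/(tform3 _ _ _) tform3_tassoc //; exact: incl_form.
under eq_bigr do rewrite exchange_big /=.
rewrite exchange_big /=; apply: eq_bigr => i _.
under eq_bigr do rewrite bform_sum.
rewrite bform_sum; apply: eq_bform => x y.
rewrite (pair2E _ etaS zetaS) mulr_sumr; apply: eq_bigr => q _.
by rewrite mulr_sumr.
Qed.

End GradedDual.

(** * Bialgebra axioms for a graded pre-Lie algebra with homogeneous [rhat] *)

Section PreLieBialgebra.
Variables (K : fieldType) (V : int -> vectType K).
Local Notation L := (dsum V).
Variable dot : L -> L -> L.
Hypothesis dot_bilinear : bilinear_for *:%R *:%R dot.
Hypothesis dot_ext_l : forall a, extendable (dot a).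
Hypothesis dot_ext_r : forall a, extendable (dot^~ a).

Local Infix "**" := dot (at level 38, left associativity).

Lemma dot_linear_l a : linear (dot^~ a).
Proof. exact: dot_bilinear.1. Qed.

Lemma dot_linear_r a : linear (dot a).
Proof. exact: dot_bilinear.2. Qed.

Lemma dotDl a b c : (a + b) ** c = a ** c + b ** c.
Proof. by rewrite -[a]scale1r dot_linear_l !scale1r. Qed.

Lemma dotBl a b c : (a - b) ** c = a ** c - b ** c.
Proof. by rewrite addrC -scaleN1r dot_linear_l scaleN1r addrC. Qed.

Lemma dotDr a b c : a ** (b + c) = a ** b + a ** c.
Proof. by rewrite -[b]scale1r dot_linear_r !scale1r. Qed.

Lemma dotBr a b c : a ** (b - c) = a ** b - a ** c.
Proof. by rewrite addrC -scaleN1r dot_linear_r scaleN1r addrC. Qed.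

Lemma dot0l a : 0 ** a = 0.
Proof. by rewrite -[X in X ** _](subrr 0) dotBl subrr. Qed.

Lemma dot0r a : a ** 0 = 0.
Proof. by rewrite -[X in _ ** X](subrr 0) dotBr subrr. Qed.

Lemma dotNl a b : (- a) ** b = - (a ** b).
Proof. by rewrite -[- a]sub0r dotBl dot0l sub0r. Qed.

Lemma dotNr a b : a ** (- b) = - (a ** b).
Proof. by rewrite -[- b]sub0r dotBr dot0r sub0r. Qed.

Definition commutator a b := a ** b - b ** a.

Lemma commutator_linear a : linear (commutator a).
Proof.
by move=> c x y; rewrite /commutator dot_linear_r dot_linear_l scalerBr opprD addrACA.
Qed.

Lemma commutator_ext a : extendable (commutator a).
Proof.
move=> p; have [S SP] := extendable_fset (dot_ext_l a) p.
have [S' SP'] := extendable_fset (dot_ext_r a) p.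
apply: sub_finite_set (finite_fset (S `|` S')%fset) => i /= [x].
apply: contra_neqT; rewrite inE negb_or => /andP[iS iS'].
by rewrite -[LHS]/((a ** incl i x) p - (incl i x ** a) p) SP // SP' // subr0.
Qed.

Lemma gdual_dotl a xi : gdual xi -> gdual (fun x => xi (a ** x)).
Proof. exact: (gdual_comp (@dot_linear_r a) (dot_ext_l a)). Qed.

Lemma gdual_dotr a xi : gdual xi -> gdual (fun x => xi (x ** a)).
Proof. exact: (gdual_comp (@dot_linear_l a) (dot_ext_r a)). Qed.

Lemma gdual_comm a xi : gdual xi -> gdual (fun x => xi (commutator a x)).
Proof. exact: (gdual_comp (@commutator_linear a) (@commutator_ext a)). Qed.

Lemma pair2_lact T x xi eta : gdual xi -> gdual eta ->
  pair2 (lact dot x T) xi eta =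
  pair2 T (fun y => xi (x ** y)) eta + pair2 T xi (fun y => eta (commutator x y)).
Proof.
move=> gx ge; rewrite /lact (formD (pair2P gx ge)) pair2_cmap_l //; try exact: dot_linear_r.
by rewrite pair2_cmap_r //; [exact: commutator_linear|exact: commutator_ext].
Qed.

Section Homogeneous.
Variables (m : int) (T : ctensor V V).
Hypothesis T_homog : forall p q, p + q + m != 0 -> T p q = 0.

(* T as a linear map on the graded dual; the degree condition makes the values
   finite sums. *)
Definition contract (xi : L -> K) : L :=
  \sum_(p \in [set: int])
    incl (- m - p) (tlift (fun x y => xi (incl p x) *: y) (T p (- m - p))).

Lemma pair2_contract xi eta : gdual xi -> gdual eta ->
  pair2 T xi eta = eta (contract xi).
Proof.
move=> [xil [S xiS]] [etal _]; rewrite /pair2 /contract (fsbigTE S); last first.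
  by move=> p pS; rewrite fsbig1 // => q _; apply: tform_0l => x; exact: xiS.
rewrite (fsbigTE S); last first.
  move=> p pS; rewrite tlift_eq0 ?incl0 // => x y.
  by rewrite xiS // scale0r.
rewrite (form_sum etal); apply: eq_bigr => p _.
rewrite (fsbigTE [fset - m - p]%fset) => [|q]; last first.
  rewrite inE => qp; rewrite T_homog ?tform0 //.
  by apply: contraNneq qp => pqm; apply/eqP/(addrI p)/(addIr m); rewrite pqm; ring.
rewrite big_seq_fset1 (form_tlift (f := fun y => eta (incl (- m - p) y))).
  by apply: eq_bform => x y; rewrite (formZ (incl_form etal)).
exact: incl_form.
Qed.

End Homogeneous.

Lemma cswap_homog m (T : ctensor V V) :
  (forall p q, p + q + m != 0 -> T p q = 0) ->
  forall p q, p + q + m != 0 -> cswap T p q = 0.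
Proof. by move=> H p q pq; rewrite /cswap H ?/tswap ?linear0 // (addrC q). Qed.

Variables (m : int) (rhat : ctensor V V).
Hypothesis rhat_homog : forall p q, p + q + m != 0 -> rhat p q = 0.

Definition rho := contract m rhat.
Definition rho' := contract m (cswap rhat).
(** The map attached to the skew tensor [rhat - cswap rhat], through which invariance enters. *)
Definition sg xi := rho xi - rho' xi.

Lemma rhoE xi eta : gdual xi -> gdual eta -> pair2 rhat xi eta = eta (rho xi).
Proof. exact: pair2_contract. Qed.

Lemma rho'E xi eta : gdual xi -> gdual eta -> pair2 rhat xi eta = xi (rho' eta).
Proof.
move=> gx ge; rewrite -pair2_swap //; apply: pair2_contract => //.
exact: cswap_homog.
Qed.

Lemma rho_adj xi eta : gdual xi -> gdual eta -> eta (rho xi) = xi (rho' eta).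
Proof. by move=> gx ge; rewrite -rhoE // rho'E. Qed.

Lemma sg_skew xi eta : gdual xi -> gdual eta -> eta (sg xi) = - xi (sg eta).
Proof.
move=> gx ge; have [xl _] := gx; have [el _] := ge.
by rewrite /sg (formB xl) (formB el) rho_adj // (rho_adj ge gx) opprB.
Qed.

Lemma pair2_delta x xi eta : gdual xi -> gdual eta ->
  pair2 (delta_of dot rhat x) xi eta =
  - (xi (x ** rho' eta) + eta (commutator x (rho xi))).
Proof.
move=> gx ge; rewrite /delta_of (formN (pair2P gx ge)) pair2_lact //.
by rewrite rho'E ?rhoE //; [exact: gdual_comm|exact: gdual_dotl].
Qed.

(** The formula of [pair2_delta] is, in [x], a combination of multiplications by fixed elements of
    [L]. This yields linearity and extendability of the cobracket, and lets the resulting functional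
    be fed to [rho] and [rho'] again. *)
Lemma delta_of_gdual xi eta : gdual xi -> gdual eta ->
  gdual (fun x => pair2 (delta_of dot rhat x) xi eta).
Proof.
move=> gx ge; have [xl _] := gx; have [el _] := ge.
have -> : (fun x => pair2 (delta_of dot rhat x) xi eta) =
    (fun x => -1 * (fun y => xi (y ** rho' eta)) x +
       (fun y => eta (commutator (rho xi) y)) x).
  apply/funext => x; rewrite pair2_delta // /commutator !(formB el); ring.
by apply: gdual_lin; [exact: gdual_dotr|exact: gdual_comm].
Qed.

Lemma delta_of_linear : linear (delta_of dot rhat).
Proof.
move=> a x y; apply/eqP; rewrite -subr_eq0; apply/eqP; apply: pair2_eq0 => xi eta gx ge.
rewrite (formB (pair2P gx ge)) (pair2P gx ge).
by rewrite (delta_of_gdual gx ge).1 subrr.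
Qed.

Lemma delta_of_extendable2 : extendable2 (delta_of dot rhat).
Proof.
move=> p q.
pose xi i : L -> K := fun x => coord (vbasis {:V p}) i (x p).
pose eta j : L -> K := fun x => coord (vbasis {:V q}) j (x q).
have gx i : gdual (xi i) by exact/component_gdual/coord_linear.
have ge j : gdual (eta j) by exact/component_gdual/coord_linear.
(* [V p] and [V q] are finite-dimensional, so finitely many pairs of coordinate functionals detect
   the component [p q]; the union of the finite supports of the resulting functionals bounds the
   relevant degrees. *)
pose S i j := sval (cid (delta_of_gdual (gx i) (ge j)).2).
have SP i j := svalP (cid (delta_of_gdual (gx i) (ge j)).2).
pose R := (\bigcup_(i <- enum 'I__) \bigcup_(j <- enum 'I__) S i j)%fset.
apply: sub_finite_set (finite_fset R) => k /= [x].
apply: contra_neqT => kS; apply/matrixP => i j; rewrite tensorE.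
rewrite -pair2_component ?mxE; [|exact: coord_linear|exact: coord_linear].
apply: (SP i j); apply: contra kS => kS.
apply/bigfcupP; exists i; rewrite ?mem_enum //.
by apply/bigfcupP; exists j; rewrite ?mem_enum.
Qed.

Hypothesis dot_prelie : forall x y z,
  x ** y ** z - x ** (y ** z) = y ** x ** z - y ** (x ** z).

Lemma delta_of_compat2 a b :
  delta_of dot rhat (a ** b - b ** a)
    - cmap_r (fun y => y ** b - b ** y) (delta_of dot rhat a)
    - cmap_r (fun y => a ** y - y ** a) (delta_of dot rhat b)
    - cmap_l (dot a) (delta_of dot rhat b)
    + cmap_l (dot b) (delta_of dot rhat a) = 0.
Proof.
apply: pair2_eq0 => xi eta gx ge; have [xl _] := gx; have [el _] := ge.
have Nbl : linear (fun y => y ** b - b ** y).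
  by move=> c y z; rewrite dot_linear_r dot_linear_l scalerBr opprD addrACA.
have Nbe : extendable (fun y => y ** b - b ** y).
  move=> p; apply: sub_finite_set (commutator_ext b p) => i [x /= xp].
  exists x; rewrite -oppr_eq0.
  by rewrite -[X in X != _]/((- commutator b (incl i x) : L) p) opprB.
have gNb := gdual_comp Nbl Nbe ge.
have gcb := gdual_comm a ge; have gla := gdual_dotl a gx; have glb := gdual_dotl b gx.
rewrite (formD (pair2P gx ge)) !(formB (pair2P gx ge)).
rewrite !pair2_cmap_r ?pair2_cmap_l //; first last; try exact: dot_linear_r.
- exact: commutator_ext.
- exact: commutator_linear.
rewrite -/(commutator a) !pair2_delta //.
(* Composite functionals under [rho'] are moved under [rho], where they cancel the commutator terms
   in which [a] or [b] acts on the first leg. *)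
rewrite -(rho_adj gla gNb) -(rho_adj glb gcb) /commutator.
rewrite !dotBl !dotBr !(formB xl) !(formB el).
have xP := congr1 xi (dot_prelie a b (rho' eta)).
have eP := congr1 eta (dot_prelie a b (rho xi)).
have eP2 := congr1 eta (dot_prelie a (rho xi) b).
have eP3 := congr1 eta (dot_prelie b (rho xi) a).
move: xP eP eP2 eP3; rewrite !(formB xl) !(formB el) => xP eP eP2 eP3.
apply: (eq_by (eqrB (eqrB eP2 eP3) (eqrD xP eP))); ring.
Qed.

(** Lets invariance be checked on functionals, as is done later for the product on [A] and [B];
    [sg_inv] is the converse, used to exploit invariance. *)
Lemma shat_inv_of :
  (forall x xi eta, gdual xi -> gdual eta ->
    eta (x ** sg xi) - eta (sg xi ** x) = xi (x ** sg eta)) ->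
  forall x, lact dot x (rhat - cswap rhat) = 0.
Proof.
move=> H x; apply: pair2_eq0 => xi eta gx ge; have [xl _] := gx; have [el _] := ge.
have gxx := gdual_dotl x gx; have gee := gdual_comm x ge.
rewrite pair2_lact // (formB (pair2P gxx ge)) (formB (pair2P gx gee)) !pair2_swap //.
rewrite (rho'E gxx ge) (rhoE gx gee) (rhoE ge gxx) (rho'E gee gx) /commutator.
have := H x xi eta gx ge.
rewrite /sg !dotBr !dotBl !(formB xl) !(formB el) => E.
by apply: (eq_by E); ring.
Qed.

(** Read off the adjunction, which avoids comparing the supports in [contract]. Additivity serves
    the reduction to a spanning set of functionals. *)
Lemma rhoD xi xi' : gdual xi -> gdual xi' ->
  rho (fun x => xi x + xi' x) = rho xi + rho xi'.
Proof.
move=> gx gx'; apply/eqP; rewrite -subr_eq0; apply/eqP; apply: gdual_sep => eta ge.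
have gg := gdualD gx gx'.
rewrite (formB ge.1 _ (_ + _)) (formD ge.1 (rho xi)).
by rewrite (rho_adj gg ge) (rho_adj gx ge) (rho_adj gx' ge) subrr.
Qed.

Lemma rho'D eta eta' : gdual eta -> gdual eta' ->
  rho' (fun x => eta x + eta' x) = rho' eta + rho' eta'.
Proof.
move=> ge ge'; apply/eqP; rewrite -subr_eq0; apply/eqP; apply: gdual_sep => xi gx.
have gg := gdualD ge ge'.
rewrite (formB gx.1 _ (_ + _)) (formD gx.1 (rho' eta)).
by rewrite -(rho_adj gx gg) -(rho_adj gx ge) -(rho_adj gx ge') subrr.
Qed.

Hypothesis shat_inv : forall x, lact dot x (rhat - cswap rhat) = 0.

Lemma sg_inv x xi eta : gdual xi -> gdual eta ->
  eta (x ** sg xi) - eta (sg xi ** x) = xi (x ** sg eta).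
Proof.
move=> gx ge; have [xl _] := gx; have [el _] := ge.
have gxx := gdual_dotl x gx; have gee := gdual_comm x ge.
have := congr1 (fun T => pair2 T xi eta) (shat_inv x).
rewrite pair2_lact // (form0 (pair2P gx ge)).
rewrite (formB (pair2P gxx ge)) (formB (pair2P gx gee)) !pair2_swap //.
rewrite (rho'E gxx ge) (rhoE gx gee) (rhoE ge gxx) (rho'E gee gx) /commutator.
rewrite /sg !dotBr !dotBl !(formB xl) !(formB el) => E.
by apply: (eq_by E); ring.
Qed.



(** Flipping [pair2_delta] alone would produce [rho' xi] and [rho eta]. Invariance trades them for
    [rho xi] and [rho' eta], the elements that occur in the unflipped formula, so that the two can
    be combined. *)
Lemma pair2_delta_swap x xi eta : gdual xi -> gdual eta ->
  pair2 (cswap (delta_of dot rhat x)) xi eta =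
  - (eta (x ** rho xi) + xi (commutator x (rho' eta))).
Proof.
move=> gx ge; rewrite pair2_swap // pair2_delta //.
have := sg_inv x ge gx; rewrite /commutator /sg !dotBr !dotBl.
rewrite !(formB gx.1) !(formB ge.1) => E.
by apply: (eq_by (esym E)); ring.
Qed.

Lemma delta_of_compat1 a b :
  (delta_of dot rhat (a ** b) - cswap (delta_of dot rhat (a ** b)))
    - cmap_l (dot a) (delta_of dot rhat b - cswap (delta_of dot rhat b))
    - cmap_r (dot a) (delta_of dot rhat b - cswap (delta_of dot rhat b))
    - cmap_r (dot^~ b) (delta_of dot rhat a)
    + cmap_l (dot^~ b) (cswap (delta_of dot rhat a)) = 0.
Proof.
apply: pair2_eq0 => xi eta gx ge; have [xl _] := gx; have [el _] := ge.
rewrite (formD (pair2P gx ge)) !(formB (pair2P gx ge)).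
rewrite !pair2_cmap_r ?pair2_cmap_l //; try exact: dot_linear_r; try exact: dot_linear_l.
have gax := gdual_dotl a gx; have gae := gdual_dotl a ge.
have gbx := gdual_dotr b gx; have gbe := gdual_dotr b ge.
rewrite (formB (pair2P gax ge)) (formB (pair2P gx gae)).
rewrite !pair2_delta ?pair2_delta_swap // /commutator.
(* The terms with [a] acting on one leg and [b] on the other involve [rho] or [rho'] of composite
   functionals; adjunction pairs them off. *)
have e1 := rho_adj gax gbe; have e2 := rho_adj gbx gae.
rewrite !dotBl !dotBr !(formB xl) !(formB el).
have := congr1 xi (dot_prelie a (rho' eta) b).
have := congr1 eta (dot_prelie a (rho xi) b).
rewrite !(formB xl) !(formB el) => eP xP.
apply: (eq_by (eqrB eP (eqrD xP (eqrD e1 e2)))); ring.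
Qed.

(** The S-equation paired with [xi], [eta], [zeta]; [rhat_S_equation] recovers the componentwise
    form from it. *)
Hypothesis S_id : forall xi eta zeta, gdual xi -> gdual eta -> gdual zeta ->
  xi (rho' eta ** rho' zeta) - eta (rho xi ** rho' zeta)
  - zeta (commutator (rho xi) (rho eta)) = 0.

(* The product on the graded dual that is transposed to delta. *)
Definition star xi eta : L -> K := fun x => pair2 (delta_of dot rhat x) xi eta.

(** This is the S-equation after one adjunction: [- rho'] is multiplicative from [star] to the
    product of [L]. *)
Lemma rho'_star xi eta zeta : gdual xi -> gdual eta -> gdual zeta ->
  xi (rho' (star eta zeta)) = - xi (rho' eta ** rho' zeta).
Proof.
move=> gx ge gz; rewrite -rho_adj //; last exact: delta_of_gdual.
rewrite /star pair2_delta //.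
by apply: (eq_by (S_id gx ge gz)); ring.
Qed.

(** Write [rho] as [rho' + sg]: the first summand is multiplicative up to sign, and the skewness of
    [sg] turns the second into the cobracket evaluated at [sg zeta]. *)
Lemma rho_star xi eta zeta : gdual xi -> gdual eta -> gdual zeta ->
  zeta (rho (star xi eta)) =
  xi (sg zeta ** rho' eta) + eta (commutator (sg zeta) (rho xi))
  - zeta (rho' xi ** rho' eta).
Proof.
move=> gx ge gz; have gs := delta_of_gdual gx ge.
have -> : rho (star xi eta) = rho' (star xi eta) + sg (star xi eta).
  by rewrite /sg addrC subrK.
rewrite (formD gz.1) rho'_star // sg_skew // /star pair2_delta //; ring.
Qed.

(** In the sum of [sg_inv] for both orders of [xi] and [eta], the left multiplications cancel. *)
Lemma sg_dotr c xi eta : gdual xi -> gdual eta ->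
  eta (sg xi ** c) = - xi (sg eta ** c).
Proof.
move=> gx ge; apply: (eq_by (esym (eqrD (sg_inv c gx ge) (sg_inv c ge gx)))); ring.
Qed.

(* Paired with xi, eta, zeta, the terms free of sg cancel by the pre-Lie identity;
   the others cancel because rhat - cswap rhat is annihilated by
   L_x (x) 1 + 1 (x) ad_x, so that R_c (x) 1 and
   1 (x) R_c agree on it. *)
Lemma delta_of_coprelie x :
  cmap2_r (delta_of dot rhat) (delta_of dot rhat x)
    - cswap12 (cmap2_r (delta_of dot rhat) (delta_of dot rhat x)) =
  cmap2_l (delta_of dot rhat) (delta_of dot rhat x)
    - cswap12 (cmap2_l (delta_of dot rhat) (delta_of dot rhat x)).
Proof.
have dl := delta_of_linear; have de := delta_of_extendable2.
apply/eqP; rewrite -subr_eq0; apply/eqP; apply: pair3_eq0 => xi eta zeta gx ge gz.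
have [xl _] := gx; have [el _] := ge; have [zl _] := gz.
rewrite !(formB (pair3P gx ge gz)) !pair3_swap12 //.
rewrite !pair3_cmap2_r // !pair3_cmap2_l // -!/(star _ _).
have gxe := delta_of_gdual gx ge; have gex := delta_of_gdual ge gx.
have gez := delta_of_gdual ge gz; have gxz := delta_of_gdual gx gz.
have gzx := gdual_comm x gz.
rewrite !pair2_delta //.
rewrite (rho'_star (gdual_dotl x gx) ge gz) (rho'_star (gdual_dotl x ge) gx gz).
rewrite (rho_star gx ge gzx) (rho_star ge gx gzx).
rewrite /star !pair2_delta //.
have rhoD th : rho th = rho' th + sg th by rewrite /sg addrC subrK.
rewrite !rhoD /commutator.
set a := rho' xi; set b := rho' eta; set c := rho' zeta.
set t := sg xi; set k := sg eta.
set zx := fun y => zeta (x ** y - y ** x); set w := sg zx.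
have i1 := sg_inv w gx ge.
have i3 := sg_inv a ge gzx; have i4 := sg_inv b gx gzx; have i5 := sg_inv k gx gzx.
have i7 := sg_inv (x ** c) ge gx.
(* Combined, [i8], [i11] and [i10] give [eta (x ** (t ** c)) = xi (x ** k ** c) - xi (k ** x ** c)];
   the auxiliary elements [sx] and [se] serve only as intermediaries and cancel in the final
   combination. *)
have i8 := sg_dotr c gx (gdual_dotl x ge).
have i10 := sg_inv x ge (gdual_dotr c gx).
have i11 := sg_skew (gdual_dotr c gx) (gdual_dotl x ge).
have pe := congr1 eta (dot_prelie x (a + t) c).
have px := congr1 xi (dot_prelie x b c).
have p1 := congr1 zeta (dot_prelie x (a + t) (b + k)).
have p2 := congr1 zeta (dot_prelie x (b + k) (a + t)).
have p3 := congr1 zeta (dot_prelie (a + t) (b + k) x).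
move: i1 i3 i4 i5 i7 i8 i10 i11 pe px p1 p2 p3.
rewrite /commutator -/zx -/w -/t -/k /zx.
set sx := sg (fun y => xi (y ** c)); set se := sg (fun y => eta (x ** y)).
clearbody a b c t k w sx se => {zx}.
rewrite !(dotDl, dotDr, dotNl, dotNr) !(formD xl, formN xl, formD el, formN el,
  formD zl, formN zl) => i1 i3 i4 i5 i7 i8 i10 i11 pe px p1 p2 p3.
apply: (eq_by (eqrD (eqrB (eqrD (eqrD i1 i3) (eqrD i7 i8))
  (eqrD (eqrD i4 i5) (eqrD i10 i11))) (eqrB (eqrD pe (eqrD p1 p3)) (eqrD px p2)))).
ring.
Qed.

Lemma contract_component T p f : linear_for *%R f ->
  contract m T (fun x => f (x p)) =
  incl (- m - p) (tlift (fun x y => f x *: y) (T p (- m - p))).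
Proof.
move=> fl; rewrite /contract (fsbigTE [fset p]%fset) => [|i].
  rewrite big_seq_fset1; congr incl; apply: eq_tlift => x y.
  by rewrite incl_component.
rewrite inE eq_sym => ip; rewrite tlift_eq0 ?incl0 // => x y.
by rewrite incl_component_out // (form0 fl) scale0r.
Qed.

Lemma form_rho (F : L -> K) p f : linear_for *%R F -> linear_for *%R f ->
  F (rho (fun x => f (x p))) = bform (fun x y => f x * F (incl (- m - p) y)) (rhat p (- m - p)).
Proof.
move=> Fl fl; rewrite /rho contract_component //.
rewrite (form_tlift (f := fun y => F (incl (- m - p) y)) (incl_form Fl)).
by apply: eq_bform => x y; rewrite (formZ (incl_form Fl)).
Qed.

Lemma form_rho' (F : L -> K) q g : linear_for *%R F -> linear_for *%R g ->
  F (rho' (fun x => g (x q))) =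
  bform (fun x y => g y * F (incl (- m - q) x)) (rhat (- m - q) q).
Proof.
move=> Fl gl; rewrite /rho' contract_component //.
rewrite (form_tlift (f := fun y => F (incl (- m - q) y)) (incl_form Fl)).
rewrite /cswap /tswap (form_tlift (@bformP _ _ _ _)); apply: eq_bform => x y.
rewrite -[LHS]/(tlift (W := K^o) _ _) (@tlift_tens _ _ _ K^o) ?(formZ (incl_form Fl)) //.
split=> [z|z] c z1 z2; rewrite !(formZ (incl_form Fl)) ?gl ?(incl_form Fl); last first.
  by rewrite mulrDr mulrCA.
by rewrite mulrDl -mulrA.
Qed.

Lemma degE p q : q != - m - p -> p + q + m != 0.
Proof. by apply: contra_neq => pqm; apply/(addrI p)/(addIr m); rewrite pqm; ring. Qed.

(** By homogeneity the output degrees determine the two consumed degrees, so each family of the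
    S-equation has at most one nonzero member; finite support and the value of the sum follow
    together. *)
Lemma S_term1_eq0 p q s k : k != (- m - q, - m - s) -> S_term1 dot rhat p q s k = 0.
Proof.
case: k => k1 k2; rewrite xpair_eqE negb_and => /orP[]/degE kq; rewrite /S_term1 /=.
  by rewrite (@rhat_homog k1) ?tlift0 // (addrC k1).
by apply: tlift_eq0 => a b; rewrite (@rhat_homog k2) ?tlift0 // (addrC k2).
Qed.

Lemma S_term2_eq0 p q s k : k != (- m - p, - m - s) -> S_term2 dot rhat p q s k = 0.
Proof.
case: k => k1 k2; rewrite xpair_eqE negb_and => /orP[]/degE kq; rewrite /S_term2 /=.
  by rewrite (@rhat_homog p k1) ?tlift0.
by apply: tlift_eq0 => a b; rewrite (@rhat_homog k2) ?tlift0 // (addrC k2).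
Qed.

Lemma S_term3_eq0 p q s k : k != (- m - p, - m - q) -> S_term3 dot rhat p q s k = 0.
Proof.
case: k => k1 k2; rewrite xpair_eqE negb_and => /orP[]/degE kq; rewrite /S_term3 /=.
  by rewrite (@rhat_homog p k1) ?tlift0.
by apply: tlift_eq0 => a b; rewrite (@rhat_homog q) ?tlift0.
Qed.

Lemma fsum_single (T : choiceType) (W : zmodType) (F : T -> W) k0 :
  (forall k, k != k0 -> F k = 0) ->
  finite_support_family F /\ \sum_(k \in [set: T]) F k = F k0.
Proof.
move=> F0; split.
  by apply: sub_finite_set (finite_set1 k0) => k /=; apply: contra_neqP => /eqP; exact: F0.
rewrite (fsbigTE [fset k0]%fset) ?big_seq_fset1 // => k.
by rewrite inE; exact: F0.
Qed.

Lemma rhat_S_equation : S_equation dot rhat.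
Proof.
move=> p q s.
have [f1 ->] := fsum_single (@S_term1_eq0 p q s).
have [f2 ->] := fsum_single (@S_term2_eq0 p q s).
have [f3 ->] := fsum_single (@S_term3_eq0 p q s).
split=> //; apply: tensor3_eq0 => f g h fl gl hl.
have tP : linear_for *%R (tform3 f g h) by exact: tformP.
pose xi : L -> K := fun x => f (x p); pose eta : L -> K := fun x => g (x q).
pose zeta : L -> K := fun x => h (x s).
have gx : gdual xi by exact: component_gdual.
have ge : gdual eta by exact: component_gdual.
have gz : gdual zeta by exact: component_gdual.
have lx a : linear_for *%R (fun x => xi (a ** x)) := (gdual_dotl a gx).1.
have rx a : linear_for *%R (fun x => xi (x ** a)) := (gdual_dotr a gx).1.
have ly a : linear_for *%R (fun x => eta (a ** x)) := (gdual_dotl a ge).1.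
have ry a : linear_for *%R (fun x => eta (x ** a)) := (gdual_dotr a ge).1.
have lz a : linear_for *%R (fun x => zeta (commutator a x)) := (gdual_comm a gz).1.
have rz a : linear_for *%R (fun x => zeta (commutator x a)).
  move=> c y z; rewrite /commutator dot_linear_l dot_linear_r.
  by rewrite !(formB gz.1) !gz.1; ring.
rewrite !(formB tP) -[RHS](S_id gx ge gz); congr (_ - _ - _).
- rewrite (form_rho' (rx _) gl) /S_term1 (form_tlift tP); apply: eq_bform => a b.
  rewrite (form_rho' (lx _) hl) (form_tlift tP) mulr_bform; apply: eq_bform => a' b'.
  rewrite /tform3 !tform_tens //; last exact: tformP.
  by rewrite /xi /=; ring.
- rewrite (form_rho (ry _) fl) /S_term2 (form_tlift tP); apply: eq_bform => a b.
  rewrite (form_rho' (ly _) hl) (form_tlift tP) mulr_bform; apply: eq_bform => a' b'.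
  rewrite /tform3 !tform_tens //; last exact: tformP.
  by rewrite /eta /=; ring.
- rewrite (form_rho (rz _) fl) /S_term3 (form_tlift tP); apply: eq_bform => a b.
  rewrite (form_rho (lz _) gl) (form_tlift tP) mulr_bform; apply: eq_bform => a' b'.
  rewrite /tform3 !tform_tens //; last exact: tformP.
  by rewrite /zeta /commutator /=; ring.
Qed.

Theorem quasi_triangular : completed_quasi_triangular dot rhat.
Proof.
split=> //; last exact: rhat_S_equation.
split=> //.
- split.
  + exact: delta_of_linear.
  + exact: delta_of_extendable2.
  + exact: delta_of_coprelie.
- exact: delta_of_compat1.
- exact: delta_of_compat2.
Qed.

End PreLieBialgebra.

(** * The graded pre-Lie product on the tensor product of [A] and [B] *)

Section GradedTensor.
Variables (K : fieldType) (A : vectType K) (B : int -> vectType K).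
Local Notation L := (dsum (AB A B)).

Lemma componentD (V : int -> vectType K) (X Y : dsum V) p : (X + Y) p = X p + Y p.
Proof. by []. Qed.

Lemma incl_tens i (a : A) (z : B i) :
  incl (K := K) (V := AB A B) i (a *t z) = pten a (incl i z).
Proof.
apply/dsumP => j; rewrite [RHS]/(a *t (incl i z j)).
have [->|ij] := eqVneq j i; first by rewrite !incl_component.
by rewrite !incl_component_out //; apply/matrixP => k l; rewrite !mxE linear0 mulr0.
Qed.

Lemma ptenZl c (a : A) (x : dsum B) : pten (c *: a) x = c *: pten a x.
Proof.
apply/dsumP => i; rewrite -[LHS]/((c *: a) *t x i) -[RHS]/(c *: (a *t x i)).
by apply/matrixP => k l; rewrite !mxE linearZ /= mulrA.
Qed.

(** Coefficients are absorbed into the left factor of a pure tensor, so closure of [P] under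
    addition is enough. *)
Lemma incl_ind (P : L -> Prop) i (t : AB A B i) :
  P 0 -> (forall X Y, P X -> P Y -> P (X + Y)) ->
  (forall a (z : B i), P (pten a (incl i z))) -> P (incl i t).
Proof.
move=> P0 PD Pp; pose g : {linear AB A B i -> L} :=
  HB.pack (fun t => incl i t) (GRing.isLinear.Build _ _ _ _ _ (@incl_is_linear _ _ i)).
rewrite -[incl i t]/(g t) -(tlift_id t) /tlift linear_sum; elim/big_ind: _ => // k _.
rewrite linear_sum; elim/big_ind: _ => // l _.
by rewrite linearZ /= incl_tens -ptenZl.
Qed.

Lemma dsumAB_ind (P : L -> Prop) :
  P 0 -> (forall X Y, P X -> P Y -> P (X + Y)) ->
  (forall a i (z : B i), P (pten a (incl i z))) -> forall X, P X.
Proof.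
move=> P0 PD Pp X; have [S XS] := dsum_supp X.
rewrite (dsum_decomp X) (fsbigTE S); last by move=> i /XS ->; exact: incl0.
by elim/big_ind: _ => // i _; exact: incl_ind.
Qed.

Lemma gext_linear (W : lmodType K) (f : A -> dsum B -> W) : linear (gext f).
Proof.
move=> c X Y; have [S XS] := dsum_supp X; have [S' YS] := dsum_supp Y.
have XU i : i \notin (S `|` S')%fset -> X i = 0.
  by rewrite inE negb_or => /andP[/XS].
have YU i : i \notin (S `|` S')%fset -> Y i = 0.
  by rewrite inE negb_or => /andP[_ /YS].
have XYU i : i \notin (S `|` S')%fset -> (c *: X + Y) i = 0.
  by move=> iS; rewrite -[LHS]/(c *: X i + Y i) XU // YU // scaler0 addr0.
rewrite (gextE _ XU) (gextE _ YU) (gextE _ XYU) scaler_sumr -big_split.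
by apply: eq_bigr => i _; rewrite -[(c *: X + Y) i]/(c *: X i + Y i) linearP.
Qed.

Lemma form_pten (xi : L -> K) a x y : linear_for *%R xi ->
  xi (pten a (x + y)) = xi (pten a x) + xi (pten a y).
Proof.
move=> xil; have : pten a (1 *: x + y) = 1 *: pten a x + pten a y.
  exact: (pten_bilinear A B).2.
by rewrite !scale1r => ->; rewrite (formD xil).
Qed.

Section Product.
Variables (succ prec : {bilinear A -> A -> A}) (dia : dsum B -> dsum B -> dsum B).
Hypothesis dia_bilinear : bilinear_for *:%R *:%R dia.
Local Notation dot := (AB_dot succ prec dia).

Lemma AB_dot_bilinear : bilinear_for *:%R *:%R dot.
Proof.
split=> [Y|X] c Z T; first exact: gext_linear.
pose g a x b y := pten (succ a b) (dia x y) - pten (prec b a) (dia y x).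
transitivity (gext (fun a x => c *: gext (g a x) Z + gext (g a x) T) X).
  by congr (gext _ X); apply/funext => a; apply/funext => x; exact: gext_linear.
exact: gextP.
Qed.

Lemma AB_dotE a b x y :
  dot (pten a x) (pten b y) = pten (succ a b) (dia x y) - pten (prec b a) (dia y x).
Proof.
apply: AB_dot_pten => //.
  by split=> [z|z] c s t; rewrite ?linearPl ?linearPr.
by split=> [z|z] c s t; rewrite ?linearPl ?linearPr.
Qed.

Hypothesis dia_graded : forall i j x y,
  homog i x -> homog j y -> homog (i + j) (dia x y).

Lemma incl_homog (V : int -> vectType K) i (z : V i) : homog i (incl i z).
Proof. by move=> k ki; rewrite incl_component_out. Qed.

Lemma AB_dot_graded a b i j (x : B i) (y : B j) p : p != i + j ->
  dot (pten a (incl i x)) (pten b (incl j y)) p = 0.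
Proof.
move=> pij; rewrite AB_dotE.
have d1 := dia_graded (incl_homog x) (incl_homog y) pij.
have d2 : dia (incl j y) (incl i x) p = 0.
  by apply: (dia_graded (incl_homog y) (incl_homog x)); rewrite addrC.
rewrite -[LHS]/(_ *t dia _ _ p - _ *t dia _ _ p) d1 d2.
by apply/matrixP => k l; rewrite !mxE linear0 !mulr0 subr0.
Qed.

Lemma AB_dot_pten_extl a i (z : B i) j t p : j != p - i ->
  dot (pten a (incl i z)) (incl j t) p = 0.
Proof.
move=> jp; apply: (@incl_ind (fun Y => dot (pten a (incl i z)) Y p = 0)).
- by rewrite (dot0r AB_dot_bilinear).
- by move=> X Y X0 Y0; rewrite (dotDr AB_dot_bilinear) componentD X0 Y0 addr0.
- move=> b y; apply: AB_dot_graded; apply: contra_neq jp => ->; ring.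
Qed.

Lemma AB_dot_pten_extr a i (z : B i) j t p : j != p - i ->
  dot (incl j t) (pten a (incl i z)) p = 0.
Proof.
move=> jp; apply: (@incl_ind (fun Y => dot Y (pten a (incl i z)) p = 0)).
- by rewrite (dot0l AB_dot_bilinear).
- by move=> X Y X0 Y0; rewrite (dotDl AB_dot_bilinear) componentD X0 Y0 addr0.
- move=> b y; apply: AB_dot_graded; apply: contra_neq jp => ->; ring.
Qed.

Lemma AB_dot_extl X : extendable (dot X).
Proof.
apply: extendable_of_fset => p; move: X; apply: dsumAB_ind.
- by exists fset0 => i x _; rewrite (dot0l AB_dot_bilinear).
- move=> X Y [S XS] [S' YS]; exists (S `|` S')%fset => i x.
  rewrite inE negb_or => /andP[/XS X0 /YS Y0].
  by rewrite (dotDl AB_dot_bilinear) componentD X0 Y0 addr0.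
- move=> a i z; exists [fset p - i]%fset => j t; rewrite inE.
  exact: AB_dot_pten_extl.
Qed.

Lemma AB_dot_extr X : extendable (dot^~ X).
Proof.
apply: extendable_of_fset => p; move: X; apply: dsumAB_ind.
- by exists fset0 => i x _; rewrite (dot0r AB_dot_bilinear).
- move=> X Y [S XS] [S' YS]; exists (S `|` S')%fset => i x.
  rewrite inE negb_or => /andP[/XS X0 /YS Y0].
  by rewrite (dotDr AB_dot_bilinear) componentD X0 Y0 addr0.
- move=> a i z; exists [fset p - i]%fset => j t; rewrite inE.
  exact: AB_dot_pten_extr.
Qed.

Hypothesis dia_zinbiel : forall x y z, dia x (dia y z) = dia (dia x y) z + dia (dia y x) z.
Hypothesis HA : leibniz_dendriform succ prec.

Lemma form_ptenD (xi : L -> K) x : linear_for *%R xi ->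
  linear_for *%R (fun a => xi (pten a x)).
Proof.
move=> xil c a b; rewrite -xil; congr xi; exact: (pten_bilinear A B).1.
Qed.

Lemma AB_prelie X Y Z :
  dot (dot X Y) Z - dot X (dot Y Z) = dot (dot Y X) Z - dot Y (dot X Z).
Proof.
have DB := AB_dot_bilinear.
apply/eqP; rewrite -subr_eq0; apply/eqP; apply: gdual_sep => xi [xil _].
rewrite !(formB xil).
move: X Y Z; apply: dsumAB_ind => [Y Z|X X' HX HX' Y Z|a i x].
- by rewrite !(dot0l DB, dot0r DB) !(form0 xil) !subrr.
- rewrite !(dotDl DB, dotDr DB) !(formD xil).
  by apply: (eq_by (eqrD (HX Y Z) (HX' Y Z))); ring.
apply: dsumAB_ind => [Z|Y Y' HY HY' Z|b j y].
- by rewrite !(dot0l DB, dot0r DB) !(form0 xil) !subrr.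
- rewrite !(dotDl DB, dotDr DB) !(formD xil).
  by apply: (eq_by (eqrD (HY Z) (HY' Z))); ring.
apply: dsumAB_ind => [|Z Z' HZ HZ'|c k z].
- by rewrite !(dot0l DB, dot0r DB) !(form0 xil) !subrr.
- rewrite !(dotDl DB, dotDr DB) !(formD xil).
  by apply: (eq_by (eqrD HZ HZ')); ring.
move: (incl i x) (incl j y) (incl k z) => {}x {}y {}z.
rewrite !AB_dotE !(dotBl DB, dotBr DB) !AB_dotE !(formB xil).
rewrite !dia_zinbiel !(form_pten _ _ _ xil).
have pl t w w' : xi (pten (w + w') t) = xi (pten w t) + xi (pten w' t).
  exact: formD (form_ptenD t xil) w w'.
have pN t w : xi (pten (- w) t) = - xi (pten w t).
  exact: formN (form_ptenD t xil) w.
(* The Zinbiel identity has rewritten every product as a sum of monomials of the shape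
   [dia (dia _ _) _]. There are six of them, one per ordering of [x], [y], [z], and the coefficient
   of each vanishes by one axiom: the first when [z] comes last, the second when [z] is in the
   middle, the third when [z] comes first. *)
have u := congr1 (fun t => xi (pten t (dia (dia x y) z))) (ld_axiom1 HA a b c).
have v := congr1 (fun t => xi (pten t (dia (dia y x) z))) (ld_axiom1 HA b a c).
have q1 := congr1 (fun t => xi (pten t (dia (dia x z) y))) (ld_axiom2 HA a c b).
have q2 := congr1 (fun t => xi (pten t (dia (dia z x) y))) (ld_axiom3 HA c a b).
have p1 := congr1 (fun t => xi (pten t (dia (dia y z) x))) (ld_axiom2 HA b c a).
have p2 := congr1 (fun t => xi (pten t (dia (dia z y) x))) (ld_axiom3 HA c b a).
move: u v q1 q2 p1 p2; rewrite /ld_circ !linearDl !linearDr !(pl, pN) => u v q1 q2 p1 p2.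
apply: (eq_by (eqrD (eqrB u v) (eqrB (eqrD p1 p2) (eqrD q1 q2)))); ring.
Qed.

End Product.
End GradedTensor.

(** * Functionals built from [omega], dual bases, and the contractions of [rhat] *)

Section QuadraticZinbiel.
Variables (K : fieldType) (A : vectType K) (B : int -> vectType K).
Variables (dia : dsum B -> dsum B -> dsum B) (omega : dsum B -> dsum B -> K).
Hypothesis Hdia : quadratic_graded_zinbiel dia omega.
Variable m : int.
Hypothesis omega_deg : forall i j x y,
  homog i x -> homog j y -> i + j + m != 0 -> omega x y = 0.
Local Notation L := (dsum (AB A B)).

Lemma omega_linl y : linear_for *%R (fun x => omega x y).
Proof. by move=> c a b; exact: (omega_bilinear Hdia).1. Qed.

Lemma omega_linr x : linear_for *%R (omega x).
Proof. by move=> c a b; exact: (omega_bilinear Hdia).2. Qed.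

(* With omega_dia_sum: among the values of omega (dia - -) - on permutations of
   x, y, z only two are linearly independent. *)
Lemma omega_dia_sym x y z : omega (dia x y) z = omega (dia z y) x.
Proof. by rewrite !(omega_invariant Hdia) addrC. Qed.

Lemma omega_dia_sum x y z :
  omega (dia x y) z = - omega (dia x z) y - omega (dia z x) y.
Proof.
rewrite (omega_invariant Hdia) (formD (omega_linr y)).
by rewrite !(omega_skew Hdia y).
Qed.

Lemma gdual_omega y : gdual (omega^~ y).
Proof.
split; first exact: omega_linl.
(* The degree [j] part of [y] pairs only with degree [- m - j]. *)
have [S yS] := dsum_supp y; exists [fset (- m - j) | j in S]%fset => i x iS.
rewrite (dsum_decomp y) (fsbigTE S); last by move=> j /yS ->; exact: incl0.
rewrite (form_sum (omega_linr _)) big_seq big1 // => j jS.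
apply: (omega_deg (incl_homog x) (incl_homog (y j))).
apply: contraNneq iS => ijm; apply/imfsetP; exists j => //=.
by apply/eqP; rewrite -subr_eq0 -ijm; apply/eqP; ring.
Qed.

(** A functional on [L], not the flip, which is [tswap] or [cswap] here. *)
Definition tau (al : A -> K) (y : dsum B) : L -> K :=
  gext (W := K^o) (fun a x => al a * omega x y).

Lemma tau_pten al y a x : linear_for *%R al -> tau al y (pten a x) = al a * omega x y.
Proof.
move=> all; apply: (@gext_pten _ _ _ K^o (fun a x => al a * omega x y)).
split=> [z|b] c s t; first by rewrite all mulrDl -mulrA.
by rewrite omega_linl mulrDr mulrCA.
Qed.

Lemma tau_linear al y : linear_for *%R (tau al y).
Proof. exact: (@gext_linear _ _ _ K^o). Qed.

Lemma tau_supp al y (S : {fset int}) : linear_for *%R al ->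
  (forall i x, i \notin S -> omega (incl i x) y = 0) ->
  forall i t, i \notin S -> tau al y (incl i t) = 0.
Proof.
move=> all yS i t iS; have tl := @tau_linear al y.
apply: (@incl_ind _ _ _ (fun X => tau al y X = 0)).
- exact: form0.
- by move=> X Y X0 Y0; rewrite (formD tl) X0 Y0 addr0.
- by move=> a z; rewrite tau_pten // yS // mulr0.
Qed.

Lemma gdual_tau al y : linear_for *%R al -> gdual (tau al y).
Proof.
move=> all; split; first exact: tau_linear.
by have [_ [S yS]] := gdual_omega y; exists S; exact: tau_supp.
Qed.

Lemma pair2_omega (t : ctensor B B) y1 y2 :
  pair2 t (omega^~ y1) (omega^~ y2) = omega_hat omega t y1 y2.
Proof.
have [_ [S1 S1P]] := gdual_omega y1; have [_ [S2 S2P]] := gdual_omega y2.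
rewrite /omega_hat -(fsbig_widen ([set` S1] `*` [set` S2]) setT) //; last first.
  move=> [p q] [_ /= pq]; apply: (@tlift_eq0 _ _ _ K^o) => x1 x2 /=.
  have [pS|/S1P ->] := boolP (p \in S1); last by rewrite mul0r.
  have [qS|/S2P ->] := boolP (q \in S2); last by rewrite mulr0.
  by case: pq.
rewrite -(pair_fsbig _ (fun p q => tform (fun x => omega (incl p x) y1)
  (fun x => omega (incl q x) y2) (t p q))) //.
rewrite (pair2E _ S1P S2P) fsbig_finite //= set_fsetK; apply: eq_bigr => p _.
by rewrite fsbig_finite //= set_fsetK.
Qed.

(** On these functionals the [A] part and the [B] part separate, and the [B] part is the quantity by
    which [is_eta] characterises the copairing. *)
Lemma pair2_bullet (s : tensor A A) (t : ctensor B B) al be y1 y2 :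
  linear_for *%R al -> linear_for *%R be ->
  pair2 (bullet s t) (tau al y1) (tau be y2) = tform al be s * omega_hat omega t y1 y2.
Proof.
move=> all bel; rewrite -pair2_omega.
have [_ [S1 S1P]] := gdual_omega y1; have [_ [S2 S2P]] := gdual_omega y2.
rewrite (pair2E _ (tau_supp all S1P) (tau_supp bel S2P)) (pair2E _ S1P S2P).
rewrite mulr_sumr; apply: eq_bigr => p _; rewrite mulr_sumr; apply: eq_bigr => q _.
have tl1 := (gdual_tau y1 all).1; have tl2 := (gdual_tau y2 bel).1.
rewrite /bullet tform_tlift mulrC mulr_bform; apply: eq_bform => a1 a2.
rewrite tform_tlift mulrC mulr_bform; apply: eq_bform => x1 x2.
rewrite tform_tens; [|exact: incl_form|exact: incl_form].
by rewrite !incl_tens !tau_pten //; ring.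
Qed.

(** The coefficients are forced by duality. The expansion is stated for every finite set containing
    [J0], so that several expansions can be written over one index set. *)
Lemma basis_expand (Omega : choiceType) (e f : Omega -> dsum B) :
  homogeneous_basis e -> dual_families omega e f ->
  forall b, exists J0 : {fset Omega}, (forall j, j \notin J0 -> omega b (f j) = 0) /\
    forall J : {fset Omega}, (J0 `<=` J)%fset -> b = \sum_(j <- J) omega b (f j) *: e j.
Proof.
move=> He Hef b; have [c [/finite_fsetP[J0 cJ0] bE]] := basis_span He b.
have cS j : j \notin J0 -> c j = 0.
  move=> jJ; apply/eqP/negPn/negP => cj; move/negP: jJ; apply.
  by have : [set` J0] j by rewrite -cJ0.
have bJ : b = \sum_(j <- J0) c j *: e j.
  by rewrite bE (fsbigTE J0) // => j /cS ->; rewrite scale0r.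
have wc j : omega b (f j) = c j.
  rewrite bJ (form_sum (omega_linl (f j))).
  have E i : omega (c i *: e i) (f j) = c i * (i == j)%:R.
    by rewrite (formZ (omega_linl (f j))) Hef.
  under eq_bigr do rewrite E.
  have [jJ|jJ] := boolP (j \in J0).
    rewrite (big_fsetD1 j) //= eqxx mulr1 big_seq big1 ?addr0 // => i.
    by rewrite !inE => /andP[/negbTE -> _]; rewrite mulr0.
  rewrite big_seq big1 ?cS // => i iJ.
  by case: eqVneq iJ jJ => [-> ->|]; rewrite ?mulr0.
exists J0; split=> [j|J J0J]; first by rewrite wc; exact: cS.
rewrite [LHS]bJ; under eq_bigr do rewrite -wc.
by apply: big_fset_incl => // j _ /cS; rewrite -wc => ->; rewrite scale0r.
Qed.

Lemma homog_incl (V : int -> vectType K) i (x : dsum V) : homog i x -> x = incl i (x i).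
Proof.
move=> xi; apply/dsumP => j; have [->|ji] := eqVneq j i; first by rewrite incl_component.
by rewrite incl_component_out ?xi.
Qed.

(** A basis of the finite-dimensional [B p] involves finitely many [e j] in total. Any other [e j]
    with a nonzero component in degree [p] would, being homogeneous, lie in [B p] and hence be
    orthogonal to [f j], whereas [omega (e j) (f j)] is 1. *)
Lemma basis_component (Omega : choiceType) (e f : Omega -> dsum B) :
  homogeneous_basis e -> dual_families omega e f ->
  forall p, exists J0 : {fset Omega}, forall j, j \notin J0 -> e j p = 0.
Proof.
move=> He Hef p; pose b k := incl p (vbasis {:B p})`_k.
pose J k := sval (cid (basis_expand He Hef (b k))).
have JP k := (svalP (cid (basis_expand He Hef (b k)))).1.
exists (\bigcup_(k <- enum 'I_(\dim {:B p})) J k)%fset => j jJ; apply/eqP.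
apply: contraTT (oner_neq0 K) => ejp; rewrite negbK.
have [d ed] := basis_homog He j.
have dp : d = p by apply/eqP; apply: contraNT ejp => dp; rewrite ed // eq_sym.
rewrite -[1]/((true : nat)%:R) -(eqxx j) -Hef dp in ed *.
rewrite (homog_incl ed) (coord_vbasis (memvf (e j p))).
rewrite (form_sum (incl_form (omega_linl (f j)))) big1 // => k _.
rewrite (formZ (incl_form (omega_linl (f j)))) JP ?mulr0 //.
by apply: contra jJ => jk; apply/bigfcupP; exists k; rewrite ?mem_enum.
Qed.

Variables (Omega : choiceType) (e f : Omega -> dsum B).
Hypotheses (He : homogeneous_basis e) (Hf : homogeneous_basis f).
Hypothesis Hef : dual_families omega e f.

Lemma basis_expand_f b : exists J0 : {fset Omega}, forall J : {fset Omega},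
  (J0 `<=` J)%fset -> b = \sum_(j <- J) omega (e j) b *: f j.
Proof.
(* Skew-symmetry makes [- e] the dual family of [f], so the expansion in [e] can be reused; the two
   signs cancel. *)
have Hfe : dual_families omega f (fun j => - e j).
  by move=> i j; rewrite (omega_skew Hdia) (formN (omega_linl _)) opprK Hef eq_sym.
have [J0 [_ J0P]] := basis_expand Hf Hfe b; exists J0 => J /J0P {1}->.
by apply: eq_bigr => j _; rewrite (omega_skew Hdia) (formN (omega_linl _)) opprK.
Qed.

Lemma gdual_basis (xi : L -> K) : gdual xi ->
  exists J0 : {fset Omega}, forall a j, j \notin J0 -> xi (pten a (e j)) = 0.
Proof.
move=> [xil [S xiS]]; pose J p := sval (cid (basis_component He Hef p)).
have JP p := svalP (cid (basis_component He Hef p)).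
exists (\bigcup_(p <- S) J p)%fset => a j jJ.
rewrite (gdual_decomp _ xil xiS) big_seq big1 // => p pS.
rewrite (_ : pten a (e j) p = 0) ?incl0 ?(form0 xil) //.
rewrite -[LHS]/(a *t (e j p)) JP; first by apply/matrixP => k l; rewrite !mxE linear0 mulr0.
by apply: contra jJ => jp; apply/bigfcupP; exists p; rewrite ?pS.
Qed.

(** An induction principle expressing that the functionals [tau al y] span the restricted dual:
    identities additive in a functional need checking only on them. *)
Lemma gdual_tau_ind (P : (L -> K) -> Prop) :
  (forall xi xi', gdual xi -> gdual xi' -> P xi -> P xi' -> P (fun X => xi X + xi' X)) ->
  (forall al y, linear_for *%R al -> P (tau al y)) ->
  forall xi, gdual xi -> P xi.
Proof.
move=> PD Pt xi gx; have [J JP] := gdual_basis gx; have [xil _] := gx.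
pose al k := coord (vbasis {:A}) k.
(* Chosen so that [omega (e j) (y k)] equals the value of [xi] on the [k]-th basis vector of [A]
   tensored with [e j]; by [gdual_basis] finitely many [j] suffice. *)
pose y (k : 'I_(\dim {:A})) := \sum_(j <- J) xi (pten (vbasis {:A})`_k (e j)) *: f j.
have all k : linear_for *%R (al k) by exact: coord_linear.
have -> : xi = (fun X => \sum_k tau (al k) (y k) X).
  apply/funext; apply: dsumAB_ind => [|X Y EX EY|a i z].
  - by rewrite (form0 xil) big1 // => k _; rewrite (form0 (gdual_tau _ _).1).
  - by rewrite (formD xil) EX EY -big_split; apply: eq_bigr => k _; rewrite (formD (gdual_tau _ _).1).
  move: (incl i z) => {z} x.
  have [J' [J'0 J'E]] := basis_expand He Hef x.
  have xa w : linear_for *%R (fun a => xi (pten a w)) := form_ptenD w xil.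
  rewrite {1}(coord_vbasis (memvf a)) (form_sum (xa _)); apply: eq_bigr => k _.
  rewrite (formZ (xa _)) tau_pten //; congr (_ * _).
  rewrite /y (form_sum (omega_linr x)).
  have xr : linear_for *%R (fun w => xi (pten (vbasis {:A})`_k w)).
    by move=> c s t; rewrite -xil; congr xi; exact: (pten_bilinear A B).2.
  rewrite {1}(J'E (J `|` J')%fset) ?fsubsetUr // (form_sum xr).
  rewrite -(big_fset_incl _ (fsubsetUl J J')) => [|j _ jJ]; last first.
    by rewrite (formZ xr) JP // mulr0.
  by apply: eq_bigr => j _; rewrite (formZ xr) (formZ (omega_linr x)) mulrC.
suff [] : gdual (fun X => \sum_k tau (al k) (y k) X) /\ P (fun X => \sum_k tau (al k) (y k) X) by [].
elim: (index_enum _) => [|k s [gs Ps]].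
  have zl : linear_for *%R (fun _ : A => 0 : K) by move=> c a b; rewrite mulr0 addr0.
  (* The empty sum is itself of the form [tau], which spares a separate zero case in the hypotheses
     on [P]. *)
  rewrite (_ : (fun X => _) = tau (fun _ => 0) 0); first by split; [exact: gdual_tau|exact: Pt].
  apply/funext; apply: dsumAB_ind => [|X Y|a i z]; rewrite ?big_nil.
  - by rewrite (form0 (gdual_tau _ _).1).
  - by rewrite (formD (gdual_tau _ _).1) // => <- <-; rewrite addr0.
  - by rewrite tau_pten // mul0r.
rewrite (_ : (fun X => _) = fun X => tau (al k) (y k) X + \sum_(i <- s) tau (al i) (y i) X).
  split; [apply: gdualD|apply: PD] => //; try exact: gdual_tau.
  exact: Pt.
by apply/funext => X; rewrite big_cons.
Qed.

Variables (n : nat) (u v : 'I_n -> A).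
Local Notation rhat := (AB_rhat u v e f).

Lemma AB_rhat_homog p q : p + q + m != 0 -> rhat p q = 0.
Proof.
move=> pq; rewrite /AB_rhat big1 // => i _; rewrite fsbig1 // => j _.
have [d ed] := basis_homog He j; have [d' fd] := basis_homog Hf j.
rewrite -[LHS]/((u i *t e j p : AB A B p) *t (v i *t f j q : AB A B q)).
have t0r (U V : vectType K) (x : U) : x *t (0 : V) = 0.
  by apply/matrixP => k l; rewrite !mxE linear0 mulr0.
have t0l (U V : vectType K) (x : V) : (0 : U) *t x = 0.
  by apply/matrixP => k l; rewrite !mxE linear0 mul0r.
have [pd|/ed ->] := eqVneq p d; last by rewrite t0r t0l.
have [qd|/fd ->] := eqVneq q d'; last by rewrite !t0r.
have /eqP := Hef j j; rewrite eqxx (omega_deg ed fd) -?pd -?qd //.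
by rewrite eq_sym oner_eq0.
Qed.

Lemma pair2_rhat xi eta : gdual xi -> gdual eta ->
  exists J0 : {fset Omega}, forall J : {fset Omega}, (J0 `<=` J)%fset ->
  pair2 rhat xi eta =
  \sum_(i < n) \sum_(j <- J) xi (pten (u i) (e j)) * eta (pten (v i) (f j)).
Proof.
move=> gx ge; have [xil [S xiS]] := gx; have [etal [S' etaS]] := ge.
pose I p := sval (cid (basis_component He Hef p)).
have IP p := svalP (cid (basis_component He Hef p)).
exists (\bigcup_(p <- S) I p)%fset => J IJ.
rewrite (pair2E _ xiS etaS).
transitivity (\sum_(p <- S) \sum_(q <- S') \sum_(i < n) \sum_(j <- J)
    tform (fun x => xi (incl p x)) (fun y => eta (incl q y))
      (cpure (pten (u i) (e j)) (pten (v i) (f j)) p q)).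
  rewrite big_seq [RHS]big_seq; apply: eq_bigr => p pS; apply: eq_bigr => q _.
  rewrite /AB_rhat tform_sum; apply: eq_bigr => i _.
  rewrite (fsbigTE J) ?tform_sum // => j jJ.
  apply/matrixP => k l; rewrite !mxE.
  rewrite (_ : component _ p = 0) ?linear0 ?mul0r // -[LHS]/(u i *t e j p) IP.
    by apply/matrixP => k' l'; rewrite !mxE linear0 mulr0.
  apply: contra jJ => jp; apply: (fsubsetP IJ).
  by apply/bigfcupP; exists p; rewrite ?pS.
under eq_bigr do rewrite exchange_big /=.
rewrite exchange_big /=; apply: eq_bigr => i _.
under eq_bigr do rewrite exchange_big /=.
rewrite exchange_big /=; apply: eq_bigr => j _.
by rewrite -pair2_cpure // (pair2E _ xiS etaS).
Qed.

Definition rplus (al : A -> K) : A := \sum_(i < n) al (u i) *: v i.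
Definition rminus (be : A -> K) : A := \sum_(i < n) be (v i) *: u i.

Lemma rho_tau al y : linear_for *%R al -> rho m rhat (tau al y) = pten (rplus al) y.
Proof.
move=> all; apply/eqP; rewrite -subr_eq0; apply/eqP; apply: gdual_sep => eta ge.
have gt := gdual_tau y all; rewrite (formB ge.1) -(rhoE AB_rhat_homog) //.
have [J0 J0P] := pair2_rhat gt ge; have [J1 J1P] := basis_expand_f y.
rewrite (J0P (J0 `|` J1)%fset) ?fsubsetUl //.
rewrite /rplus (form_sum (form_ptenD y ge.1)) -sumrB big1 // => i _.
rewrite (formZ (form_ptenD y ge.1)) {2}(J1P (J0 `|` J1)%fset) ?fsubsetUr //.
have er : linear_for *%R (fun w => eta (pten (v i) w)).
  by move=> c s t; rewrite -ge.1; congr eta; exact: (pten_bilinear A B).2.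
rewrite (form_sum er) mulr_sumr -sumrB big1 // => j _.
by rewrite (formZ er) tau_pten // mulrA subrr.
Qed.

(** The sign is that of [omega (f j) y = - omega y (f j)]: contracting the second leg expands [- y]
    in the basis [e]. *)
Lemma rho'_tau be y : linear_for *%R be -> rho' m rhat (tau be y) = - pten (rminus be) y.
Proof.
move=> bel; apply/eqP; rewrite -subr_eq0 opprK; apply/eqP; apply: gdual_sep => xi gx.
have gt := gdual_tau y bel; rewrite (formD gx.1) -(rho'E AB_rhat_homog) //.
have [J0 J0P] := pair2_rhat gx gt; have [J1 [_ J1P]] := basis_expand He Hef y.
rewrite (J0P (J0 `|` J1)%fset) ?fsubsetUl //.
rewrite /rminus (form_sum (form_ptenD y gx.1)) -big_split big1 // => i _ /=.
rewrite (formZ (form_ptenD y gx.1)) {2}(J1P (J0 `|` J1)%fset) ?fsubsetUr //.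
have xr : linear_for *%R (fun w => xi (pten (u i) w)).
  by move=> c s t; rewrite -gx.1; congr xi; exact: (pten_bilinear A B).2.
rewrite (form_sum xr) mulr_sumr -big_split big1 // => j _ /=.
by rewrite (formZ xr) tau_pten // (omega_skew Hdia (f j)); ring.
Qed.

End QuadraticZinbiel.

(** * Scalar identities in [A] from the LD-YBE and from invariance *)

Section AffinizedLeibnizDendriform.
Variables (K : fieldType) (A : vectType K) (succ prec : {bilinear A -> A -> A}).
Hypothesis HA : leibniz_dendriform succ prec.
Variables (n : nat) (u v : 'I_n -> A).
Implicit Types al be ga : A -> K.
Local Notation rp := (rplus u v).
Local Notation rm := (rminus u v).
Local Notation r := (\sum_(i < n) u i *t v i).
Local Notation circ := (ld_circ succ prec).
Local Notation odot := (ld_odot succ prec).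
Local Notation star := (ld_star succ prec).

Lemma tform_tmap (f g : A -> A) al be (t : tensor A A) :
  linear_for *%R al -> linear_for *%R be ->
  tform al be (tmap f g t) = tform (fun a => al (f a)) (fun a => be (g a)) t.
Proof.
by move=> all bel; rewrite /tmap tform_tlift; apply: eq_bform => x y; rewrite tform_tens.
Qed.

Lemma tform_r al be : linear_for *%R al -> linear_for *%R be ->
  tform al be r = \sum_(i < n) al (u i) * be (v i).
Proof. by move=> all bel; rewrite tform_sum; apply: eq_bigr => i _; rewrite tform_tens. Qed.

Lemma form_rp al be : linear_for *%R be -> be (rp al) = \sum_(i < n) al (u i) * be (v i).
Proof. by move=> bel; rewrite (form_sum bel); apply: eq_bigr => i _; rewrite (formZ bel). Qed.

Lemma form_rm al be : linear_for *%R al -> al (rm be) = \sum_(i < n) al (u i) * be (v i).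
Proof.
by move=> all; rewrite (form_sum all); apply: eq_bigr => i _; rewrite (formZ all) mulrC.
Qed.

Lemma form_op (op : A -> A -> A) al x : (forall y, linear (op y)) ->
  linear_for *%R al -> linear_for *%R (fun a => al (op x a)).
Proof. by move=> opl all c a b; rewrite opl all. Qed.

Lemma form_opl (op : A -> A -> A) al x : (forall y, linear (op^~ y)) ->
  linear_for *%R al -> linear_for *%R (fun a => al (op a x)).
Proof. by move=> opl all c a b; rewrite opl all. Qed.

Lemma succ_l y : linear (succ^~ y). Proof. by move=> c a b; rewrite linearPl. Qed.
Lemma succ_r y : linear (succ y). Proof. by move=> c a b; rewrite linearPr. Qed.
Lemma prec_l y : linear (prec^~ y). Proof. by move=> c a b; rewrite linearPl. Qed.
Lemma prec_r y : linear (prec y). Proof. by move=> c a b; rewrite linearPr. Qed.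

Lemma circ_l y : linear (circ^~ y).
Proof. by move=> c a b; rewrite /ld_circ succ_l prec_l scalerDr addrACA. Qed.
Lemma circ_r y : linear (circ y).
Proof. by move=> c a b; rewrite /ld_circ succ_r prec_r scalerDr addrACA. Qed.
Lemma odot_l y : linear (odot^~ y).
Proof. by move=> c a b; rewrite /ld_odot succ_l prec_r scalerDr addrACA. Qed.
Lemma odot_r y : linear (odot y).
Proof. by move=> c a b; rewrite /ld_odot succ_r prec_l scalerDr addrACA. Qed.
Lemma star_r y : linear (star y).
Proof. by move=> c a b; rewrite /ld_star circ_r circ_l addrACA -scalerDr. Qed.

Lemma form_Delta_succ al be a : linear_for *%R al -> linear_for *%R be ->
  tform al be (Delta_succ succ prec r a) = al (odot a (rm be)) - be (circ (rp al) a).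
Proof.
move=> all bel; rewrite /Delta_succ (formB (tformP _ _)) !tform_tmap //.
have ol := form_op a odot_r all; have cl := form_opl a circ_l bel.
by rewrite !tform_r // (form_rm _ ol) (form_rp _ cl).
Qed.

Lemma form_Delta_prec al be a : linear_for *%R al -> linear_for *%R be ->
  tform be al (Delta_prec succ prec r a) = be (star a (rp al)) - al (prec (rm be) a).
Proof.
move=> all bel; rewrite /Delta_prec (formB (tformP _ _)) !tform_tmap //.
have sl := form_op a star_r bel; have pl := form_opl a prec_l all.
by rewrite !tform_swap // !tform_r // (form_rp _ sl) (form_rm _ pl).
Qed.

Hypothesis Hinv : ld_invariant succ prec (r + tswap r).

(** The symmetric tensor [r + tswap r] as a map from the dual of [A] to [A]; by [sg_tau] it is the
    [A] part of [sg]. *)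
Definition kap be : A := rp be + rm be.

Lemma tform_s al be : linear_for *%R al -> linear_for *%R be ->
  tform al be (r + tswap r) = al (kap be).
Proof.
move=> all bel; rewrite (formD (tformP _ _)) tform_swap // !tform_r // /kap.
rewrite (formD all) (form_rp _ all) (form_rm _ all) addrC; congr (_ + _).
Qed.

Lemma kap_sym al be : linear_for *%R al -> linear_for *%R be -> al (kap be) = be (kap al).
Proof.
move=> all bel; rewrite /kap (formD all) (formD bel) !form_rp // !form_rm // addrC.
by congr (_ + _); apply: eq_bigr => i _; rewrite mulrC.
Qed.

Lemma kap_succ al be x : linear_for *%R al -> linear_for *%R be ->
  al (odot x (kap be)) = be (circ (kap al) x).
Proof.
move=> all bel; have := congr1 (tform al be) (Hinv x).1.
rewrite /Delta_succ (formB (tformP _ _)) !tform_tmap // tform0.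
have ol := form_op x odot_r all; have cl := form_opl x circ_l bel.
rewrite !tform_s // => /eqP; rewrite subr_eq0 => /eqP ->.
by rewrite kap_sym.
Qed.

Lemma kap_prec al be x : linear_for *%R al -> linear_for *%R be ->
  al (star x (kap be)) = be (prec (kap al) x).
Proof.
move=> all bel; have := congr1 (tform al be) (Hinv x).2.
rewrite /Delta_prec (formB (tformP _ _)) !tform_tmap // tform0.
have sl := form_op x star_r all; have pl := form_opl x prec_l bel.
rewrite !tform_swap // !tform_s // => /eqP; rewrite subr_eq0 => /eqP.
by rewrite kap_sym.
Qed.

Hypothesis Hr : LD_YBE succ prec u v.

Lemma form_op2 (op : A -> A -> A) al (c d : 'I_n -> K) (x y : 'I_n -> A) :
  (forall z, linear (op z)) -> (forall z, linear (op^~ z)) -> linear_for *%R al ->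
  al (op (\sum_i c i *: x i) (\sum_j d j *: y j)) =
  \sum_i \sum_j c i * d j * al (op (x i) (y j)).
Proof.
move=> opr opl all; rewrite (form_sum (form_opl _ opl all)); apply: eq_bigr => i _.
rewrite (formZ (form_opl _ opl all)) (form_sum (form_op _ opr all)) mulr_sumr.
by apply: eq_bigr => j _; rewrite (formZ (form_op _ opr all)) mulrA.
Qed.

Lemma form_YBE al be ga :
  linear_for *%R al -> linear_for *%R be -> linear_for *%R ga ->
  ga (circ (rp be) (rp al)) - be (odot (rp al) (rm ga)) - al (succ (rm be) (rm ga)) = 0.
Proof.
move=> all bel gal; rewrite -[RHS](form0 (tformP (tform al be) ga)) -[in RHS]Hr.
rewrite (form_sum (tformP _ _)).
rewrite (form_op2 _ _ _ _ circ_r circ_l gal) (form_op2 _ _ _ _ odot_r odot_l bel).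
rewrite (form_op2 _ _ _ _ succ_r succ_l all) -!sumrB; apply: eq_bigr => i _.
rewrite (form_sum (tformP _ _)) -!sumrB; apply: eq_bigr => j _.
rewrite !(formB (tformP _ _)) !tform_tens //; try exact: tformP.
ring.
Qed.

(* form_YBE for be, al, ga, with rp be and rm al replaced by - rm be and - rp al:
   by invariance the difference vanishes. *)
Lemma form_YBE' al be ga :
  linear_for *%R al -> linear_for *%R be -> linear_for *%R ga ->
  ga (circ (rp al) (rp be)) + al (odot (rm be) (rm ga)) + be (succ (rp al) (rm ga)) = 0.
Proof.
move=> all bel gal; have Y := form_YBE bel all gal.
have i1 := kap_succ (rm ga) all bel; have i2 := kap_prec (rm ga) all bel.
move: Y i1 i2; rewrite /kap /ld_star /ld_odot /ld_circ.
rewrite !(linearDl, linearDr) !(formD all, formD bel, formD gal) => Y i1 i2.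
apply: (eq_by (eqrD Y (eqrB i2 i1))); ring.
Qed.


(** * Transfer of the identities to the tensor product of [A] and [B] *)

Variables (B : int -> vectType K) (dia : dsum B -> dsum B -> dsum B).
Variable omega : dsum B -> dsum B -> K.
Hypothesis Hdia : quadratic_graded_zinbiel dia omega.
Variable m : int.
Hypothesis omega_deg : forall i j x y,
  homog i x -> homog j y -> i + j + m != 0 -> omega x y = 0.
Variables (Omega : choiceType) (e f : Omega -> dsum B).
Hypotheses (He : homogeneous_basis e) (Hf : homogeneous_basis f).
Hypothesis Hef : dual_families omega e f.
Local Notation L := (dsum (AB A B)).
Local Notation dot := (AB_dot succ prec dia).
Local Notation rhat := (AB_rhat u v e f).
Local Notation tau := (tau (A := A) omega).
Local Notation rho := (rho m rhat).
Local Notation rho' := (rho' m rhat).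

Lemma AB_S_id (xi eta zeta : L -> K) : gdual xi -> gdual eta -> gdual zeta ->
  xi (dot (rho' eta) (rho' zeta)) - eta (dot (rho xi) (rho' zeta))
  - zeta (commutator dot (rho xi) (rho eta)) = 0.
Proof.
have DB := AB_dot_bilinear succ prec dia.
have rh := AB_rhat_homog omega_deg He Hf Hef u v.
have ind := @gdual_tau_ind K A B dia omega Hdia m omega_deg Omega e f He Hef.
have rD := rhoD rh; have rD' := rho'D rh.
move=> gx ge gz; move: xi gx eta ge zeta gz; rewrite /commutator.
apply: (ind) => [xi xi' gx gx' Hx Hx' eta ge zeta gz|al y1 all].
  rewrite rD // !(dotDl DB, dotDr DB) !(formB gz.1) !(formD ge.1, formD gz.1).
  have := Hx _ ge _ gz; have := Hx' _ ge _ gz; rewrite !(formB gz.1) => E E'.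
  by apply: (eq_by (eqrD E E')); ring.
apply: (ind) => [eta eta' ge ge' He1 He2 zeta gz|be y2 bel].
  have gt := gdual_tau Hdia omega_deg y1 all.
  rewrite rD // rD' // !(dotDl DB, dotDr DB) !(formB gz.1) !(formD gt.1, formD gz.1).
  have := He1 _ gz; have := He2 _ gz; rewrite !(formB gz.1) => E E'.
  by apply: (eq_by (eqrD E E')); ring.
apply: (ind) => [zeta zeta' gz gz' Hz Hz'|ga y3 gal].
  have gt := gdual_tau Hdia omega_deg y1 all.
  have gt2 := gdual_tau Hdia omega_deg y2 bel.
  rewrite rD' // !(dotDl DB, dotDr DB) !(formD gt.1, formD gt2.1).
  by apply: (eq_by (eqrD Hz Hz')); ring.
rewrite !(rho_tau Hdia omega_deg He Hf Hef) // !(rho'_tau Hdia omega_deg He Hf Hef) //.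
rewrite !(dotNl DB, dotNr DB) opprK !(AB_dotE _ _ (zinbiel_bilinear Hdia)).
have tl1 := (gdual_tau Hdia omega_deg y1 all).1.
have tl2 := (gdual_tau Hdia omega_deg y2 bel).1.
have tl3 := (gdual_tau Hdia omega_deg y3 gal).1.
rewrite !(formB tl1, formN tl2, formB tl2, formB tl3) !(tau_pten Hdia) //.
have os := omega_dia_sym Hdia.
(* All values are expressed through [t1] (middle argument [y1]) and [t3] (middle argument [y3]); the
   value with [y2] in the middle is [- t1 - t3]. The coefficient of [t3] is then [form_YBE'], and
   that of [t1] the sum of [form_YBE] and [form_YBE']. *)
rewrite (os y2 y3 y1) (os y3 y2 y1) (omega_dia_sum Hdia y1 y2 y3) (os y3 y1 y2).
set t1 := omega (dia y2 y1) y3; set t3 := omega (dia y1 y3) y2.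
have Y := form_YBE all bel gal; have Y' := form_YBE' all bel gal.
move: Y Y'; rewrite /ld_odot /ld_circ.
rewrite !(formD all, formD bel, formD gal) => Y Y'.
apply: (eq_by (eqrD (eqrM t1 Y) (eqrM (t1 + t3) Y'))); ring.
Qed.

Lemma sg_tau al y : linear_for *%R al -> sg m rhat (tau al y) = pten (kap al) y.
Proof.
move=> all; rewrite /sg (rho_tau Hdia omega_deg He Hf Hef) //.
rewrite (rho'_tau Hdia omega_deg He Hf Hef) // opprK /kap.
have : pten (1 *: rp al + rm al) y = 1 *: pten (rp al) y + pten (rm al) y.
  exact: (pten_bilinear A B).1.
by rewrite !scale1r => ->.
Qed.

Lemma AB_sg_inv X (xi eta : L -> K) : gdual xi -> gdual eta ->
  eta (dot X (sg m rhat xi)) - eta (dot (sg m rhat xi) X) = xi (dot X (sg m rhat eta)).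
Proof.
have DB := AB_dot_bilinear succ prec dia.
have rh := AB_rhat_homog omega_deg He Hf Hef u v.
have ind := @gdual_tau_ind K A B dia omega Hdia m omega_deg Omega e f He Hef.
have sD xi1 xi2 : gdual xi1 -> gdual xi2 ->
    sg m rhat (fun x => xi1 x + xi2 x) = sg m rhat xi1 + sg m rhat xi2.
  by move=> g1 g2; rewrite /sg (rhoD rh g1 g2) (rho'D rh g1 g2) opprD addrACA.
move=> gx ge; move: X xi gx eta ge.
apply: dsumAB_ind => [xi gx eta ge|X X' HX HX' xi gx eta ge|a i x].
- by rewrite !(dot0l DB, dot0r DB) !(form0 ge.1) (form0 gx.1) subrr.
- rewrite !(dotDl DB X X') !(dotDr DB _ X X') !(formD ge.1, formD gx.1).
  by apply: (eq_by (eqrD (HX _ gx _ ge) (HX' _ gx _ ge))); ring.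
apply: (ind) => [xi xi' gx gx' Hx Hx' eta ge|al y1 all].
  rewrite sD // (dotDl DB (sg _ _ xi)) (dotDr DB _ (sg _ _ xi)) !(formD ge.1).
  by apply: (eq_by (eqrD (Hx _ ge) (Hx' _ ge))); ring.
have tl1 := (gdual_tau Hdia omega_deg y1 all).1.
apply: (ind) => [eta eta' ge ge' He1 He2|be y2 bel].
  rewrite sD // (dotDr DB _ (sg _ _ eta)) (formD tl1).
  by apply: (eq_by (eqrD He1 He2)); ring.
have tl2 := (gdual_tau Hdia omega_deg y2 bel).1.
rewrite !sg_tau // !(AB_dotE _ _ (zinbiel_bilinear Hdia)).
rewrite !(formB tl1, formB tl2) !(tau_pten Hdia) //.
move: (incl i x) => {}x; have os := omega_dia_sym Hdia.
rewrite (os y2 x y1) (omega_dia_sum Hdia x y2 y1).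
set t1 := omega (dia x y1) y2; set tx := omega (dia y1 x) y2.
have i1 := kap_succ a all bel; have i2 := kap_prec a bel all.
move: i1 i2; rewrite /ld_star /ld_odot /ld_circ.
rewrite !(formD all, formD bel) => i1 i2.
apply: (eq_by (eqrD (eqrM t1 i2) (eqrM (t1 + tx) i1))); ring.
Qed.

Variable eta0 : dsum B -> ctensor B B.
Hypothesis Heta : is_eta dia omega eta0.

Lemma linear_add (W W' : lmodType K) (g : W -> W') x y : linear g -> g (x + y) = g x + g y.
Proof. by move=> gl; have := gl 1 x y; rewrite !scale1r. Qed.

(** Tested on functionals [tau], the left side factors by [pair2_bullet] into contractions of [r]
    times values of [omega], and the right side is computed from the contractions [rho] and [rho'];
    both become the same expression in two independent values of [omega]. *)
Lemma AB_delta_eq X : AB_delta succ prec r eta0 X = delta_of dot rhat X.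
Proof.
have DB := AB_dot_bilinear succ prec dia.
have el := AB_dot_extl succ prec (zinbiel_bilinear Hdia) (zinbiel_graded Hdia).
have er := AB_dot_extr succ prec (zinbiel_bilinear Hdia) (zinbiel_graded Hdia).
have rh := AB_rhat_homog omega_deg He Hf Hef u v.
have dl := delta_of_linear DB el er rh.
have al_lin : linear (AB_delta succ prec r eta0) by exact: gext_linear.
have ind := @gdual_tau_ind K A B dia omega Hdia m omega_deg Omega e f He Hef.
apply/eqP; rewrite -subr_eq0; apply/eqP; apply: pair2_eq0.
move=> xi eta gx ge; move: X xi gx eta ge.
apply: dsumAB_ind => [xi gx eta ge|X X' HX HX' xi gx eta ge|a i x].
- have z (W W' : lmodType K) (g : W -> W') : linear g -> g 0 = 0.
    by move=> gl; have := gl (- 1) 0 0; rewrite !scaleN1r oppr0 addr0 addNr.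
  by rewrite (z _ _ _ dl) (z _ _ _ al_lin) subrr (form0 (pair2P gx ge)).
- rewrite (linear_add _ _ dl) (linear_add _ _ al_lin).
  move: (HX _ gx _ ge) (HX' _ gx _ ge).
  move: (AB_delta _ _ _ _ X) (AB_delta _ _ _ _ X') (delta_of _ _ X) (delta_of _ _ X').
  move=> T1 T2 T3 T4 H1 H2.
  by rewrite opprD addrACA (formD (pair2P gx ge)) H1 H2 addr0.
apply: (ind) => [xi xi' gx gx' Hx Hx' eta ge|al y1 all].
  by rewrite pair2Dl // Hx // Hx' // addr0.
have g1 := gdual_tau Hdia omega_deg y1 all.
apply: (ind) => [eta eta' ge ge' He1 He2|be y2 bel].
  by rewrite pair2Dr // He1 // He2 // addr0.
have g2 := gdual_tau Hdia omega_deg y2 bel.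
rewrite (formB (pair2P g1 g2)) (pair2_delta DB el er rh) //.
rewrite (AB_delta_pten _ _ _ Heta.1) (formB (pair2P g1 g2)).
rewrite !(pair2_bullet Hdia omega_deg) // tform_swap //.
(* [omega_hat] is read as a pairing again, so that the flip can be moved onto the two functionals
   before the defining property of the copairing is applied. *)
rewrite -(pair2_omega Hdia omega_deg (cswap _)) pair2_swap; first last.
- exact: (gdual_omega Hdia omega_deg).
- exact: (gdual_omega Hdia omega_deg).
rewrite (pair2_omega Hdia omega_deg) !Heta.2 form_Delta_succ // form_Delta_prec //.
rewrite (rho_tau Hdia omega_deg He Hf Hef) // (rho'_tau Hdia omega_deg He Hf Hef) //.
rewrite /commutator !(dotNl DB, dotNr DB) !(AB_dotE _ _ (zinbiel_bilinear Hdia)).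
rewrite !(formN g1.1, formB g1.1, formB g2.1) !(tau_pten Hdia) //.
move: (incl i x) => {}x; have os := omega_dia_sym Hdia.
rewrite !(omega_skew Hdia x) (os y1 y2 x) (os y2 y1 x) (os y2 x y1).
rewrite (omega_dia_sum Hdia x y2 y1).
set t1 := omega (dia x y1) y2; set tx := omega (dia y1 x) y2.
rewrite /ld_star /ld_odot /ld_circ !(formD all, formD bel).
ring.
Qed.

End AffinizedLeibnizDendriform.

Theorem theorem2p34 (K : fieldType)
  (A : vectType K) (succ prec : {bilinear A -> A -> A})
  (HA : leibniz_dendriform succ prec)
  (B : int -> vectType K) (dia : dsum B -> dsum B -> dsum B)
  (omega : dsum B -> dsum B -> K)
  (Hdia : quadratic_graded_zinbiel dia omega)
  (eta : dsum B -> ctensor B B) (Heta : is_eta dia omega eta)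
  (n : nat) (u v : 'I_n -> A)
  (Hr : LD_YBE succ prec u v)
  (Hinv : ld_invariant succ prec
            (\sum_(i < n) u i *t v i + tswap (\sum_(i < n) u i *t v i)))
  (Omega : choiceType) (e f : Omega -> dsum B)
  (He : homogeneous_basis e) (Hf : homogeneous_basis f)
  (Hef : dual_families omega e f) :
  let dot := AB_dot succ prec dia in
  let delta := AB_delta succ prec (\sum_(i < n) u i *t v i) eta in
  let rhat := AB_rhat u v e f in
  [/\ completed_prelie_bialgebra dot delta,
      completed_quasi_triangular dot rhat &
      forall X, delta X = delta_of dot rhat X].
Proof.
move=> dot delta rhat; have [m omega_deg] := omega_graded Hdia.
have DB : bilinear_for *:%R *:%R dot := AB_dot_bilinear succ prec dia.
have dl := AB_dot_extl succ prec (zinbiel_bilinear Hdia) (zinbiel_graded Hdia).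
have dr := AB_dot_extr succ prec (zinbiel_bilinear Hdia) (zinbiel_graded Hdia).
have rh := AB_rhat_homog omega_deg He Hf Hef u v.
have pl := AB_prelie (zinbiel_bilinear Hdia) (zinbiel_identity Hdia) HA.
have si := shat_inv_of DB dl dr rh (AB_sg_inv Hinv Hdia omega_deg He Hf Hef).
have Sid := AB_S_id Hinv Hr Hdia omega_deg He Hf Hef.
have qt : completed_quasi_triangular dot rhat := quasi_triangular DB dl dr rh pl si Sid.
have dE X : delta X = delta_of dot rhat X.
  exact: (AB_delta_eq succ prec u v Hdia omega_deg He Hf Hef Heta).
split=> //; rewrite (_ : delta = delta_of dot rhat); first exact: qt_bialgebra.
exact/funext.
Qed.
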